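(* Let $\mathcal{B}'$ be an orthonormal basis of an $n$-dimensional normed space $(E,\|\cdot\|)$ over $K=k(t)$, and let $\mathcal{B}$ be a basis of $E$ such that the transition matrix $T=T(\mathcal{B}\to\mathcal{B}')$ has polynomial entries, i.e. entries in $A=k[t]$. Then the two-stage basis reduction algorithm described in the context (Stage 1, the reduction for the integer-valued norm $\lceil\|\cdot\|\rceil$, used as a precomputation, followed by Stage 2, the reduction for $\|\cdot\|$) takes $$O\big(n^4h(T)+n^3h(T)^2\big)$$ arithmetic operations in $k$ to transform $\mathcal{B}$ into a reduced basis (of the lattice $\langle\mathcal{B}\rangle_A$). In particular, for $h(T)\ge n$ the complexity is equal to $O(n^3h(T)^2)$.
   Context: Let $k$ be a field, $A=k[t]$, $K=k(t)$, with degree function $|a/b|=\deg a-\deg b$ for nonzero $a,b\in A$, $|0|=-\infty$. A norm on an $A$-module or $K$-vector space $L$ is a map $\|\cdot\|:L\to\{-\infty\}\cup\mathbb{R}$ with $\|x+y\|\le\max\{\|x\|,\|y\|\}$, $\|ax\|=|a|+\|x\|$ for all scalars $a$, and $\|x\|=-\infty$ iff $x=0$. A lattice over $A$ is a finitely generated $A$-module $L$ with a norm such that $\dim_k\{x\in L:\|x\|\le r\}<\infty$ for all $r\in\mathbb{R}$. A normed space over $K$ is a finite-dimensional $K$-vector space with a norm containing a finitely generated $A$-submodule of full rank which is a lattice with the restricted norm (then every finitely generated $A$-submodule of full rank is a lattice). A subset $\{b_1,\dots,b_m\}\subset E\setminus\{0\}$ is reduced if $\|\sum a_ib_i\|=\max_i\|a_ib_i\|$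 for all $a_i\in K$. A basis $(b_1,\dots,b_n)$ of $E$ is orthonormal if it is reduced and $-1<\|b_1\|\le\dots\le\|b_n\|\le0$. The transition matrix $T=T(\mathcal{B}\to\mathcal{B}')\in\mathrm{GL}_n(K)$ is defined by $T(b'_1\dots b'_n)^{\mathrm{tr}}=(b_1\dots b_n)^{\mathrm{tr}}$; its rows are the coordinate vectors of the elements of $\mathcal{B}$ with respect to $\mathcal{B}'$. The height of $g=f/h\in K$ with $f,h\in A$ coprime is $h(g)=\max\{|f|,|h|\}$, and $h(T)$ is the maximum of the heights of the entries of $T$. For $a\in K$ with $|a|\le 0$, the zero coefficient $\mathrm{zc}(a)$ is the unique element of $k$ with $|a-\mathrm{zc}(a)|<0$. $\mathrm{LT}_m(k)$ denotes the set of matrices in $\mathrm{GL}_m(k)$ which, up to a permutation of rows, are lower triangular with all diagonal entries equal to $1$. Costs are measured by the number of necessary operations in $k$. Let $r_1<\dots<r_\kappa$ be the distinct lengths of the vectors of $\mathcal{B}'$, with multiplicities $m_1,\dots,m_\kappa$, and let $n_l=m_1+\dots+m_l$, $n_0=0$. Vectors of $E$ are represented by their coordinates with respect to $\mathcal{B}'$, so that $\|(a_1,\dots,a_n)\|=\max_j(|a_j|+\|b'_j\|)$ and $\lceil\|(a_1,\dots,a_n)\|\rceil=\max_j|a_j|$. The algorithm. Input: $\mathcal{B}'$ and $\mathcal{B}$. Output: the transition matrix from a reduced basis of the lattice $\langle\mathcal{B}\rangle_A$ in $(E,\|\cdot\|)$ to $\mathcal{B}'$. It applies Stage 1 to $T(\mathcal{B}\to\mathcal{B}')$,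 and then Stage 2 to the matrix returned by Stage 1. In both stages $T_1,\dots,T_n$ denote the current rows and $t_{i,j}$ the current entries of the matrix being transformed. Stage 1. Write $N(a_1,\dots,a_n)=\max_j|a_j|$. Put $s=1$. While $s<n$: sort the rows increasingly with respect to $N$; let $M=(\mathrm{zc}(t^{-N(T_i)}t_{i,j}))_{1\le i,j\le n}$; compute $P=(p_{i,j})\in\mathrm{LT}_n(k)$ such that $PM$ is in row echelon form; put $s=\mathrm{rank}(M)$; if $s<n$, then for $i=s+1,\dots,n$ let $u_i=\max\{j: p_{i,j}\ne0\}$ and replace $T_{u_i}$ by $T_{u_i}+\sum_{j<u_i}t^{N(T_{u_i})-N(T_j)}p_{i,j}T_j$, where the rows and lengths used on the right are those before this round of replacements. Return the matrix. Stage 2. Put $\mathrm{vals}=[r_1,\dots,r_\kappa]$ and $\iota=1$. While $\iota\le\#\mathrm{vals}$: sort the rows increasingly with respect to $\|\cdot\|$; determine $l$ with $\mathrm{vals}[\iota]\equiv r_l \bmod \mathbb{Z}$ and all indices $e_1<\dots<e_f$ with $\|T_{e_i}\|\equiv r_l\bmod\mathbb{Z}$; let $M=(\mathrm{zc}(t^{-\lceil\|T_{e_i}\|\rceil}t_{e_i,j}))_{1\le i\le f,\ n_{l-1}<j\le n_l}$; compute $P=(p_{i,j})\in\mathrm{LT}_f(k)$ such that $PM$ is in row echelon form; let $s=\mathrm{rank}(M)$. If $s=f$: in case $f<m_l$ and the value $\mathrm{vals}[\iota]$ does not occur in $\mathrm{vals}$ at a position larger than $\iota$, append $\mathrm{vals}[\iota]$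 to $\mathrm{vals}$. If $s<f$: for $i=s+1,\dots,f$ let $u_i=\max\{j:p_{i,j}\ne0\}$ and replace $T_{e_{u_i}}$ by $T_{e_{u_i}}+\sum_{j<u_i}t^{\lceil\|T_{e_{u_i}}\|\rceil-\lceil\|T_{e_j}\|\rceil}p_{i,j}T_{e_j}$, where the rows and lengths used on the right are those before this round of replacements; for each new row $T_{e_{u_i}}$, if $\|T_{e_{u_i}}\|-\lceil\|T_{e_{u_i}}\|\rceil$ does not occur in $\mathrm{vals}$ at a position larger than $\iota$, append it to $\mathrm{vals}$. Then increase $\iota$ by $1$. When the loop ends, return the matrix.
   Formalization: The bound O(n^4 h(T) + n^3 h(T)^2) is asserted for h(T) ≥ 1 only: for h(T) = 0 it would be zero although the algorithm still performs operations in k; termination and correctness are asserted for all h(T). *)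

(* Defs.v *)
From HB Require Import structures.
From mathcomp Require Import all_boot all_order all_fingroup all_algebra.
From mathcomp Require Import fraction generic_quotient.
From mathcomp Require Import boolp classical_sets reals constructive_ereal.

Set Implicit Arguments.
Unset Strict Implicit.
Unset Printing Implicit Defensive.

Import Order.TTheory GRing.Theory Num.Theory.
Local Open Scope classical_set_scope.
Local Open Scope ring_scope.

Notation "x %:F" := (@tofrac _ x) : ring_scope.

(* [repr x] is an arbitrary numerator/denominator pair representing [x]. *)
Definition deg (k : fieldType) (x : {fraction {poly k}}) : \bar int :=
  if x == 0 then -oo%E
  else ((size (\n_(repr x))).-1%:Z - (size (\d_(repr x))).-1%:Z)%:E.

Definition degR (R : realType) (k : fieldType) (x : {fraction {poly k}}) :
  \bar R := er_map (fun z : int => z%:~R : R) (deg x).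

(* Only meaningful for |a| <= 0. *)
Definition zc (k : fieldType) (a : {fraction {poly k}}) : k :=
  xget 0 [set c : k | (deg (a - (c%:P)%:F)%R < 0)%E].

(* For x = 0 the coprime pair is (0, 1) up to a unit, so the height is 0,
   although |0| = -oo. *)
Definition height (k : fieldType) (x : {fraction {poly k}}) : nat :=
  let f := \n_(repr x) in
  let g := \d_(repr x) in
  maxn (size (f %/ gcdp f g)).-1 (size (g %/ gcdp f g)).-1.

Definition height_mx (k : fieldType) (m n : nat)
    (T : 'M[{fraction {poly k}}]_(m, n)) : nat :=
  \max_i \max_j height (T i j).

Section Lattices.
Variables (R : realType) (k : fieldType).
Local Notation K := {fraction {poly k}}.
Variable E : vectType K.

Definition kspan (s : seq E) : set E :=
  [set x | exists a : nat -> k, x = \sum_(i < size s) ((a i)%:P)%:F *: s`_i].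

Definition Aspan (s : seq E) : set E :=
  [set x | exists a : nat -> {poly k}, x = \sum_(i < size s) (a i)%:F *: s`_i].

Definition is_norm (nrm : E -> \bar R) : Prop :=
  [/\ forall x, nrm x != +oo%E,
      forall x y, (nrm (x + y)%R <= maxe (nrm x) (nrm y))%E,
      forall (a : K) x, nrm (a *: x) = (degR R a + nrm x)%E
    & forall x, nrm x = -oo%E <-> x = 0].

(* The second clause says that {x in L : ||x|| <= r} has finite dimension
   over k. *)
Definition is_lattice (nrm : E -> \bar R) (L : set E) : Prop :=
  (exists s : seq E, L = Aspan s) /\
  forall r : R, exists s : seq E,
    [set x | L x /\ (nrm x <= r%:E)%E] = kspan s.

Definition normed_space (nrm : E -> \bar R) : Prop :=
  is_norm nrm /\
  exists s : seq E, <<s>>%VS = fullv /\ is_lattice nrm (Aspan s).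

Definition reduced_family (nrm : E -> \bar R) (n : nat) (b : n.-tuple E) : Prop :=
  (forall i, tnth b i != 0) /\
  forall a : 'I_n -> K,
    nrm (\sum_i a i *: tnth b i) = \big[maxe/-oo%E]_i nrm (a i *: tnth b i).

Definition orthonormal_basis (nrm : E -> \bar R) (n : nat) (b : n.-tuple E) : Prop :=
  [/\ basis_of fullv b,
      reduced_family nrm b,
      forall i, ((-1)%R%:E < nrm (tnth b i) <= 0)%E
    & forall i j : 'I_n, (i <= j)%N -> (nrm (tnth b i) <= nrm (tnth b j))%E].

Definition Abasis (n : nat) (L : set E) (b : n.-tuple E) : Prop :=
  Aspan b = L /\
  forall a : 'I_n -> {poly k},
    \sum_i (a i)%:F *: tnth b i = 0 -> forall i, a i = 0.

Definition transition (n : nat) (b b' : n.-tuple E) : 'M[K]_n :=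
  \matrix_(i, j) coord b' j (tnth b i).

(* The family of transition matrix U to b'. *)
Definition family_of (n : nat) (b' : n.-tuple E) (U : 'M[{poly k}]_n) :
  n.-tuple E := [tuple \sum_j (U i j)%:F *: tnth b' j | i < n].

End Lattices.

(* A value together with the number of operations in k spent to compute it.
   The operations are addition/subtraction, multiplication, inversion and the
   zero test, one unit each. Copying, permuting, shifting the coefficients of a
   polynomial, and computing with degrees, indices and lengths of vectors use
   no operation in k. *)
Definition counted (X : Type) : Type := (nat * X)%type.

Definition cret (X : Type) (x : X) : counted X := (0%N, x).

Definition cbind (X Y : Type) (u : counted X) (f : X -> counted Y) :
  counted Y := ((u.1 + (f u.2).1)%N, (f u.2).2).

Notation "'let!' x := u 'in' v" := (cbind u (fun x => v))
  (at level 200, x name, u at level 100, v at level 200).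

Definition cfold (S I : Type) (f : S -> I -> counted S) : S -> seq I -> counted S :=
  fix loop s l := if l is i :: l' then let! s' := f s i in loop s' l'
                  else cret s.

Definition ctab_mx (X : Type) (m n : nat) (f : 'I_m -> 'I_n -> counted X) :
  counted 'M[X]_(m, n) :=
  ((\sum_i \sum_j (f i j).1)%N, \matrix_(i, j) (f i j).2).

Section Operations.
Variable k : fieldType.

Definition cadd (x y : k) : counted k := (1%N, x + y).
Definition csub (x y : k) : counted k := (1%N, x - y).
Definition cmul (x y : k) : counted k := (1%N, x * y).
Definition cinv (x : k) : counted k := (1%N, x^-1).
Definition cnz (x : k) : counted bool := (1%N, x != 0).

Definition cfilter (I : Type) (p : I -> counted bool) (l : seq I) :
  counted (seq I) := ((\sum_(i <- l) (p i).1)%N, [seq i <- l | (p i).2]).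

(* The polynomial with coefficients [f 0], ..., [f d.-1]; each coefficient is
   tested against 0 in order to find the degree. *)
Definition ctab_poly (d : nat) (f : nat -> counted k) : counted {poly k} :=
  ((\sum_(i < d) ((f i).1 + (cnz (f i).2).1))%N, \poly_(i < d) (f i).2).

Definition cscale_poly (a : k) (p : {poly k}) : counted {poly k} :=
  ctab_poly (size p) (fun i => cmul a p`_i).

Definition cadd_poly (p q : {poly k}) : counted {poly k} :=
  ctab_poly (maxn (size p) (size q)) (fun i => cadd p`_i q`_i).

Definition LT_group (m : nat) (P : 'M[k]_m) : Prop :=
  P \in unitmx /\
  exists s : 'S_m, let L := row_perm s P in
    (forall i j : 'I_m, (i < j)%N -> L i j = 0) /\ (forall i, L i i = 1).

(* The leading entry of a row lies strictly to the right of the leading entries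
   of all previous rows, which are nonzero as soon as that row is. *)
Definition row_echelon (m n : nat) (A : 'M[k]_(m, n)) : Prop :=
  forall (i i' : 'I_m) (j' : 'I_n), (i < i')%N -> A i' j' != 0 ->
    exists2 j : 'I_n, (j < j')%N & A i j != 0.

(* Gaussian elimination. The state (W, Q, piv) satisfies W = Q M, and [piv] is
   the list of pivot rows found so far. In column [c] the pivot row is the first
   row outside [piv] with a nonzero entry, and only rows below it are modified:
   Q remains unipotent lower triangular. *)
Definition gauss_column (m n : nat)
    (st : 'M[k]_(m, n) * 'M[k]_m * seq 'I_m) (c : 'I_n) :
    counted ('M[k]_(m, n) * 'M[k]_m * seq 'I_m) :=
  let: (W, Q, piv) := st in
  let! cand := cfilter (fun i => cnz (W i c)) [seq i <- enum 'I_m | i \notin piv] in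
  if cand is p :: below then
    let! v := cinv (W p c) in
    let! q := ctab_mx (fun (i : 'I_m) (_ : 'I_1) =>
      if i \in below then cmul (W i c) v else cret 0) in
    let! W' := ctab_mx (fun i j =>
      if i \in below then let! x := cmul (q i 0) (W p j) in csub (W i j) x
      else cret (W i j)) in
    let! Q' := ctab_mx (fun i j =>
      if i \in below then let! x := cmul (q i 0) (Q p j) in csub (Q i j) x
      else cret (Q i j)) in
    cret (W', Q', rcons piv p)
  else cret st.

(* Returns P and the number of nonzero rows of P M. *)
Definition gauss (m n : nat) (M : 'M[k]_(m, n)) : counted ('M[k]_m * nat) :=
  let! st := cfold (@gauss_column m n) (M, 1%:M, [::]) (enum 'I_n) in
  let: (_, Q, piv) := st in
  let rows := piv ++ [seq i <- enum 'I_m | i \notin piv] in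
  cret (\matrix_(i, j) Q (nth i rows i) j, size piv).

(* "Compute P in LT_m(k) such that P M is in row echelon form; s = rank M":
   P and s are computed by [gauss] in [c] operations; the remaining clauses are
   the specification. A run of the algorithm exists only if they hold. *)
Definition echelon (m n : nat) (M : 'M[k]_(m, n)) (c : nat) (P : 'M[k]_m)
    (s : nat) : Prop :=
  [/\ gauss M = (c, (P, s)), LT_group P, row_echelon (P *m M) & s = \rank M].

(* N(a) = max_j |a_j| for a nonzero row a. It equals the ceiling of the norm of
   a, since the lengths of an orthonormal basis lie in ]-1, 0]. *)
Definition rowN (n : nat) (a : 'rV[{poly k}]_n) : nat := \max_j (size (a 0%R j)).-1.

Definition sort_rows (n : nat) (le : rel 'rV[{poly k}]_n) (T : 'M[{poly k}]_n) :
  'M[{poly k}]_n :=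
  \matrix_i nth 0 (sort le [seq row j T | j <- enum 'I_n]) i.

(* The zero coefficients for the rows [e 0], [e 1], ... and the columns [g 0],
   [g 1], ... of T. Each entry is the coefficient of t^N in a polynomial of degree
   at most N = N(T_(e i)), so it is read off without any operation. *)
Definition lead_mx (n f m : nat) (e : 'I_f -> 'I_n) (g : 'I_m -> 'I_n)
    (T : 'M[{poly k}]_n) : 'M[k]_(f, m) :=
  \matrix_(i, j) zc (('X)%:F ^- rowN (row (e i) T) * (T (e i) (g j))%:F).

(* u_i = max {j : p_(i, j) <> 0} *)
Definition last_nz (f : nat) (P : 'M[k]_f) (i : 'I_f) : 'I_f :=
  [arg max_(j > i | P i j != 0%R) (j : nat)]%N.

(* Entry [c] of T_(e u) + sum_(j < u) t^(N(T_(e u)) - N(T_(e j))) p_j T_(e j) *)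
Definition new_entry (n f : nat) (e : 'I_f -> 'I_n) (T : 'M[{poly k}]_n)
    (p : 'I_f -> k) (u : 'I_f) (c : 'I_n) : counted {poly k} :=
  cfold (fun (acc : {poly k}) (j : 'I_f) =>
      let! x := cscale_poly (p j) (T (e j) c) in
      cadd_poly acc ('X^(rowN (row (e u) T) - rowN (row (e j) T)) * x))
    (T (e u) c) [seq j : 'I_f <- enum 'I_f | (j < u)%N].

(* One round of replacements, for the row indices i >= s of P counted from 0.
   All new entries are computed from the old matrix T; the zero tests are those
   needed to find the u_i. *)
Definition replace_rows (n f : nat) (e : 'I_f -> 'I_n) (P : 'M[k]_f) (s : nat)
    (T : 'M[{poly k}]_n) : counted 'M[{poly k}]_n :=
  let! nz := ctab_mx (fun i j =>
    if (s <= i)%N then cnz (P i j) else cret false) in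
  ctab_mx (fun r c =>
    if [pick i : 'I_f | (s <= i)%N && (e (last_nz P i) == r)] is Some i
    then new_entry e T (P i) (last_nz P i) c
    else cret (T r c)).

End Operations.

(* [stage1 s T c U]: the while loop started with the variable s and the matrix T
   ends after [c] operations and returns U. *)
Inductive stage1 (k : fieldType) (n : nat) :
    nat -> 'M[{poly k}]_n -> nat -> 'M[{poly k}]_n -> Prop :=
| Stage1_end s T : ~~ (s < n)%N -> stage1 s T 0 T
| Stage1_round s T c1 P s' c2 T' c3 U :
    (s < n)%N ->
    let T0 := sort_rows (fun a b => (rowN a <= rowN b)%N) T in
    echelon (lead_mx id id T0) c1 P s' ->
    replace_rows id P s' T0 = (c2, T') ->
    stage1 s' T' c3 U ->
    stage1 s T (c1 + c2 + c3) U.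

Section Stage2.
Variables (R : realType) (k : fieldType) (n : nat).
(* w j is the length of the j-th vector of B'. *)
Variable w : 'I_n -> R.

Definition row_norm (a : 'rV[{poly k}]_n) : \bar R :=
  \big[maxe/-oo%E]_j (degR R (a 0 j)%:F%R + (w j)%:E)%E.

(* r_1 < ... < r_kappa *)
Definition lens : seq R := sort (fun x y => x <= y) (undup [seq w j | j <- enum 'I_n]).

Definition eqmodZ (x y : R) : bool := (x - y) \is a Num.int.

(* The length r_l with v = r_l mod Z *)
Definition class_of (v : R) : R := nth 0 lens (find (eqmodZ v) lens).

(* The indices n_(l-1) < j <= n_l, i.e. those of the vectors of length r_l *)
Definition columns (r : R) : seq 'I_n := [seq j <- enum 'I_n | w j == r].

Definition class_rows (r : R) (T : 'M[{poly k}]_n) : seq 'I_n :=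
  [seq i <- enum 'I_n | eqmodZ (fine (row_norm (row i T))) r].

Definition residue (a : 'rV[{poly k}]_n) : R := fine (row_norm a) - (rowN a)%:R.

Definition append (pos : nat) (vals : seq R) (x : R) : seq R :=
  if x \in drop pos.+1 vals then vals else rcons vals x.

Definition append_residues (f : nat) (e : 'I_f -> 'I_n) (P : 'M[k]_f) (s : nat)
    (T' : 'M[{poly k}]_n) (pos : nat) (vals : seq R) : seq R :=
  foldl (append pos) vals
    [seq residue (row (e (last_nz P i)) T') | i : 'I_f <- enum 'I_f & (s <= i)%N].

(* [stage2 T vals pos c U]; the position [pos] in [vals] is counted from 0. *)
Inductive stage2 :
    'M[{poly k}]_n -> seq R -> nat -> nat -> 'M[{poly k}]_n -> Prop :=
| Stage2_end T vals pos : ~~ (pos < size vals)%N -> stage2 T vals pos 0 T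
| Stage2_full T vals pos c1 P s c3 U :
    (pos < size vals)%N ->
    let v := vals`_pos in
    let T0 := sort_rows (fun a b => (row_norm a <= row_norm b)%E) T in
    let rows := class_rows (class_of v) T0 in
    let cols := columns (class_of v) in
    let e := tnth (in_tuple rows) in
    echelon (lead_mx e (tnth (in_tuple cols)) T0) c1 P s ->
    s = size rows ->
    let vals' := if (size rows < size cols)%N then append pos vals v else vals in
    stage2 T0 vals' pos.+1 c3 U ->
    stage2 T vals pos (c1 + c3) U
| Stage2_reduce T vals pos c1 P s c2 T' c3 U :
    (pos < size vals)%N ->
    let v := vals`_pos in
    let T0 := sort_rows (fun a b => (row_norm a <= row_norm b)%E) T in
    let rows := class_rows (class_of v) T0 in
    let cols := columns (class_of v) in
    let e := tnth (in_tuple rows) in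
    echelon (lead_mx e (tnth (in_tuple cols)) T0) c1 P s ->
    (s < size rows)%N ->
    replace_rows e P s T0 = (c2, T') ->
    stage2 T' (append_residues e P s T' pos vals) pos.+1 c3 U ->
    stage2 T vals pos (c1 + c2 + c3) U.

(* The whole algorithm, on the transition matrix T and the lengths w, returns U
   after [c] operations in k. *)
Definition basis_reduction (T : 'M[{poly k}]_n) (c : nat) (U : 'M[{poly k}]_n) :
  Prop :=
  exists c1 T1 c2,
    [/\ stage1 1 T c1 T1, stage2 T1 lens 0 c2 U & c = (c1 + c2)%N].

End Stage2.

(* Main.v *)
Require Import Defs.
From HB Require Import structures.
From mathcomp Require Import all_boot all_order all_fingroup all_algebra.
From mathcomp Require Import fraction generic_quotient.
From mathcomp Require Import boolp classical_sets reals constructive_ereal.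
From mathcomp Require Import zify ring lra.

Set Implicit Arguments.
Unset Strict Implicit.
Unset Printing Implicit Defensive.

Import Order.TTheory GRing.Theory Num.Theory.
Local Open Scope ring_scope.

(** Why the theorem holds.

    Let N(T_i) be the maximal degree in row i of a polynomial matrix T, and let
    the leading matrix of T consist of the coefficients of t^N(T_i) in row i
    ([leading_mx]).  A round of either stage replaces, for each of the last
    rows p_i of P, a row T_u by a combination sum_j p_(i,j) t^(N(T_u)-N(T_j)) T_j
    in which T_u itself has coefficient 1 and only rows j <= u occur.  Hence a
    round multiplies T from the left by a unitriangular matrix over k[t]: the
    lattice does not change.  In the columns covered by M, the coefficients of
    the new row in degree N(T_u) form the row p_i M, which is zero.

    Stage 1.  Here M has all columns, so N(T_u) drops.  The sum of all N(T_i) is at most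
    n h at the start, which bounds the number of replaced rows, hence of rounds
    with a replacement, by n h.  A replaced row costs O(n^2 h), and elimination
    O(n^3) per round ([stage1_spec]).  At the end the leading matrix is
    invertible.

    Stage 2.  Since the leading matrix is invertible and stays so, no N(T_i)
    changes any more; the stage is an elimination on leading matrices over k.
    The norm of row i is N(T_i) + r_l for one of the lengths r_l, the residue of
    the row, and this defines the class of the row.  A replaced row moves from
    its class to one with a smaller residue ([row_residue_replaced]), while the
    rows that stay in the class become independent ([class_indep_reduced]).
    So there are at most n^2 replaced rows, of cost O(n^2 h) each.

    The remaining point is the number of eliminations, because a class with too
    few rows is appended again although nothing has changed.  Cut the list vals
    into generations: the entries appended while generation d is processed form
    the next one.  The values in a generation are distinct, so that the
    eliminations of a whole generation cost O(n^3).  Rows only move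
    downwards; therefore the highest class that is not settled becomes settled in
    each generation, and there are at most n + 1 generations.  When all classes
    are independent, counting rows and columns shows that every class has exactly
    as many rows as columns, nothing is appended, and the loop ends
    ([stage2_spec]).

    Finally, if the leading coefficients of each class, in the columns of that
    class, are independent over k, then the coefficient that determines the norm
    of a combination cannot cancel, and the family is reduced
    ([row_norm_combination_ge]). *)

(** * Degrees of fractions *)

Section Fractions.
Variable k : fieldType.
Local Notation K := {fraction {poly k}}.
Implicit Types (p q : {poly k}) (x : K).
Local Open Scope quotient_scope.

(** Degrees and heights are defined through an arbitrary representative; this
    presentation turns statements about them into identities of polynomials. *)
Lemma fracE x : x = (\n_(repr x))%:F / (\d_(repr x))%:F.
Proof.
have fracP (a b : {ratio {poly k}}) : \n_a * \d_b = \d_a * \n_b ->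
    \pi_{fraction {poly k}} a = \pi_{fraction {poly k}} b.
  by move=> /eqP; rewrite -FracField.equivf_def => /eqP.
have d0 : (\d_(repr x))%:F != 0 :> K by rewrite tofrac_eq0 denom_ratioP.
apply: (canRL (mulfK d0)); rewrite -{1}[x]reprK.
move: (repr x) {d0} => r; unlock tofrac.
rewrite -[LHS]FracField.pi_mul; apply: fracP.
rewrite /FracField.mulf !numden_Ratio ?mulf_neq0 ?oner_eq0 ?denom_ratioP //.
by rewrite !mulr1 mulrC.
Qed.

(** If n / d is the chosen representative of p / q then p d = n q, so that both
    quotients have the same difference of sizes. *)
Lemma deg_div p q : p != 0 -> q != 0 ->
  deg (p%:F / q%:F) = ((size p)%:Z - (size q)%:Z)%:E.
Proof.
move=> p0 q0; have pF0 : p%:F != 0 :> K by rewrite tofrac_eq0.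
have qF0 : q%:F != 0 :> K by rewrite tofrac_eq0.
rewrite /deg mulf_eq0 invr_eq0 (negPf pF0) (negPf qF0) /=; congr _%:E.
move: (repr _) (fracE (p%:F / q%:F)) => r E.
have d0 : \d_r != 0 by exact: denom_ratioP.
have dF0 : (\d_r)%:F != 0 :> K by rewrite tofrac_eq0.
have e : p * \d_r = \n_r * q.
  move/eqP: E; rewrite (eqr_div _ _ qF0 dF0) -!tofracM tofrac_eq.
  exact: eqP.
have n0 : \n_r != 0.
  apply: contraNneq (mulf_neq0 p0 d0) => n0.
  by rewrite e n0 mul0r.
have := congr1 (fun p => size (polyseq p)) e; rewrite !size_mul //.
move: p0 q0 d0 n0; rewrite -!size_poly_gt0.
by move: (size p) (size q) (size \n_r) (size \d_r); lia.
Qed.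

Lemma deg_tofrac p : p != 0 -> deg p%:F = ((size p).-1%:Z)%:E.
Proof.
move=> p0; rewrite -[p%:F]divr1 -tofrac1 deg_div ?oner_eq0 // size_poly1.
by rewrite -size_poly_gt0 in p0; rewrite -predn_int.
Qed.

Lemma degR_tofrac (R : realType) p : p != 0 -> degR R p%:F = ((size p).-1%:R)%:E.
Proof. by move=> p0; rewrite /degR deg_tofrac. Qed.

Lemma degR0 (R : realType) : degR R (0 : K) = -oo%E.
Proof. by rewrite /degR /deg eqxx. Qed.

(** In a representative (p d, d) of a polynomial p the denominator is the gcd,
    up to a unit, and cancelling it leaves p. *)
Lemma height_tofrac p : ((size p).-1 <= height (p%:F : K))%N.
Proof.
have [->|p0] := eqVneq p 0; first by rewrite size_poly0.
rewrite /height leq_max; apply/orP; left.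
move: (repr _) (fracE p%:F) => r E.
have d0 : \d_r != 0 by exact: denom_ratioP.
have dF0 : (\d_r)%:F != 0 :> K by rewrite tofrac_eq0.
have e : \n_r = p * \d_r.
  move/eqP: (canLR (divfK dF0) E); rewrite -tofracM tofrac_eq eq_sym.
  by move/eqP.
have g : gcdp \n_r \d_r %= \d_r.
  by rewrite e dvdp_gcd_idr ?dvdp_mull.
have g0 : gcdp \n_r \d_r != 0 by rewrite gcdp_eq0 negb_and d0 orbT.
rewrite size_divp // (eqp_size g) e size_mul //.
by move: p0 d0; rewrite -!size_poly_gt0; move: (size p) (size \d_r); lia.
Qed.

(** t^-N p - c is the quotient of p - c t^N by t^N, and p - c t^N has degree
    below N exactly when c is the coefficient of t^N in p. *)
Lemma zcE (N : nat) p : (size p <= N.+1)%N -> zc (('X)%:F ^- N * p%:F) = p`_N.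
Proof.
move=> sp; rewrite -tofracXn /zc.
have XN0 : ('X^N)%:F != 0 :> K by rewrite tofrac_eq0 -size_poly_gt0 size_polyXn.
have key (c : k) :
    (deg ((('X^N)%:F : K)^-1 * p%:F - (c%:P)%:F)%R < 0)%E <-> c = p`_N.
  have -> : (('X^N)%:F)^-1 * p%:F - (c%:P)%:F = (p - c *: 'X^N)%:F / ('X^N)%:F :> K.
    rewrite tofracB mulrBl mulrC -mul_polyC tofracM; congr (_ - _).
    by rewrite mulfK.
  have sq : (size (p - c *: 'X^N)%R <= N.+1)%N.
    rewrite (leq_trans (size_polyD _ _)) // size_polyN geq_max sp.
    by rewrite (leq_trans (size_scale_leq _ _)) ?size_polyXn.
  have cq : (p - c *: 'X^N)`_N = p`_N - c.
    by rewrite coefB coefZ coefXn eqxx mulr1.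
  have [q0|q0] := eqVneq (p - c *: 'X^N) 0.
    rewrite q0 tofrac0 mul0r /deg eqxx; split=> // _.
    by move/eqP: cq; rewrite q0 coef0 eq_sym subr_eq0 => /eqP.
  rewrite deg_div // ?size_polyXn; last by rewrite -size_poly_gt0 size_polyXn.
  rewrite lte_fin subr_lt0 ltz_nat ltnS; split=> [lt|e].
    have := leq_sizeP _ _ lt N (leqnn _).
    by rewrite cq => /eqP; rewrite subr_eq0 => /eqP.
  apply/leq_sizeP => j; rewrite leq_eqVlt => /predU1P[<-|lt].
    by rewrite cq e subrr.
  by apply: (leq_sizeP _ _ sq).
by case: xgetP => [y _ /key //|/(_ p`_N)[]]; apply/key.
Qed.

End Fractions.

(** * Gaussian elimination *)

Definition unitriangular (R : pzRingType) (m : nat) (Q : 'M[R]_m) : Prop :=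
  (forall i j : 'I_m, (i < j)%N -> Q i j = 0) /\ forall i, Q i i = 1.

Lemma det_unitriangular (R : comPzRingType) (m : nat) (Q : 'M[R]_m) :
  unitriangular Q -> \det Q = 1.
Proof.
case=> up diag; rewrite det_trig; last exact/is_trig_mxP.
by rewrite big1 // => i _; apply: diag.
Qed.

Section Gauss.
Variables (k : fieldType) (m n : nat) (M : 'M[k]_(m, n)).

(** Invariant after the columns of index below [c].  The condition on a pivot
    row p says that some nonzero entry of p lies strictly to the left of
    the leading entries of all rows that come later in the final order, which is:
    pivots as they were found, then the other rows.  As [index i piv] equals
    [size piv] outside [piv], one comparison of indices covers both kinds. *)
Definition gauss_inv (c : nat) (st : 'M[k]_(m, n) * 'M[k]_m * seq 'I_m) : Prop :=
  let: (W, Q, piv) := st in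
  [/\ W = Q *m M, unitriangular Q, uniq piv,
    forall p, p \in piv -> exists2 j : 'I_n, W p j != 0 &
      forall (i : 'I_m) (j' : 'I_n), (index p piv < index i piv)%N ->
        (j' <= j)%N -> W i j' = 0
    & forall (i : 'I_m) (j : 'I_n), i \notin piv -> (j < c)%N -> W i j = 0].

(** The rows modified in column [c] are not pivots, so that they vanish on the
    columns before [c], as does the new pivot row [p]: no entry is created there.
    They lie below [p], which keeps Q unitriangular. *)
Lemma gauss_column_inv (c : 'I_n) st :
  gauss_inv c st -> gauss_inv c.+1 (gauss_column st c).2.
Proof.
case: st => [[W Q] piv] [eW [Qup Qdiag] upiv hpiv hrest]; rewrite /gauss_column.
rewrite {1}/cbind /= /cfilter /=.
set cand := filter _ _; have scand : sorted ltn [seq val i | i <- cand].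
  rewrite /cand; apply: (subseq_sorted ltn_trans) (iota_ltn_sorted 0 m).
  rewrite -val_enum_ord; apply: map_subseq.
  by apply: subseq_trans (filter_subseq _ _) (filter_subseq _ _).
have candP i : (i \in cand) = (i \notin piv) && (W i c != 0).
  by rewrite 2!mem_filter mem_enum andbT andbC.
case: cand scand candP => [|p below] /= scand candP.
  split=> // i j inp; rewrite ltnS leq_eqVlt => /predU1P[|]; last exact: hrest.
  by move/val_inj->; have := candP i; rewrite inp /= => /esym/negbT/negPn/eqP.
have /andP[pnp Wp0] : (p \notin piv) && (W p c != 0) by rewrite -candP mem_head.
have belowP i : i \in below -> [/\ i \notin piv, W i c != 0 & (p < i)%N].
  move=> ib; have /andP[-> ->] : (i \notin piv) && (W i c != 0).
    by rewrite -candP inE ib orbT.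
  split=> //; move: scand; rewrite (path_sortedE ltn_trans) => /andP[/allP h _].
  by apply: h; apply: map_f.
(* the multiple of row p that is subtracted from row i *)
pose x (i : 'I_m) := if i \in below then W i c * (W p c)^-1 else 0.
set W' := \matrix_(_, _) _; set Q' := \matrix_(_, _) _.
have W'E i j : W' i j = W i j - x i * W p j.
  by rewrite !mxE /x; case: ifP => //= ib; rewrite ?mxE ?ib ?mul0r ?subr0.
have Q'E i j : Q' i j = Q i j - x i * Q p j.
  by rewrite !mxE /x; case: ifP => //= ib; rewrite ?mxE ?ib ?mul0r ?subr0.
have x0 (i : 'I_m) : ~~ (p < i)%N -> x i = 0.
  by rewrite /x; case: ifP => // /belowP[_ _ ->].
have xp (i : 'I_m) : i \in piv -> x i = 0.
  by rewrite /x; case: ifP => // /belowP[/negbTE->].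
have W'0 (i : 'I_m) (j : 'I_n) : i \notin piv -> (j < c)%N -> W' i j = 0.
  by move=> ip jc; rewrite W'E !hrest // mulr0 subr0.
have W'c (i : 'I_m) : i \notin piv -> i != p -> W' i c = 0.
  move=> ip ip'; rewrite W'E /x; have := candP i.
  rewrite ip inE (negPf ip') /=; case: ifP => _ => [_|/esym/negbT/negPn/eqP->].
    by rewrite divfK // subrr.
  by rewrite mul0r subr0.
have rix (i : 'I_m) : index i (rcons piv p) =
    (if i \in piv then index i piv else (size piv + (i != p))%N).
  by rewrite -cats1 index_cat /= eq_sym; case: eqP.
split.
- apply/matrixP => i j; rewrite W'E eW !mxE mulr_sumr -sumrB.
  by apply: eq_bigr => l _; rewrite Q'E mulrBl mulrA.
- split=> [i j ij|i]; rewrite Q'E.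
    rewrite Qup //; have [pi|/x0->] := boolP (p < i)%N; last by rewrite mul0r subrr.
    by rewrite Qup ?mulr0 ?subr0 // (ltn_trans pi).
  rewrite Qdiag; have [pi|/x0->] := boolP (p < i)%N; last by rewrite mul0r subr0.
  by rewrite Qup // mulr0 subr0.
- by rewrite rcons_uniq pnp.
- move=> p'; rewrite mem_rcons inE => /predU1P[->|p'p].
    exists c; first by rewrite W'E x0 ?ltnn // mul0r subr0.
    move=> i j; rewrite !rix (negPf pnp) eqxx addn0.
    case: ifP => [ip|/negbT ip]; first by rewrite ltnNge index_size.
    rewrite -{1}[size piv]addn0 ltn_add2l lt0b => ip'.
    rewrite leq_eqVlt => /predU1P[/val_inj->|]; first exact: W'c.
    exact: W'0.
  have [j Wj hj] := hpiv _ p'p.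
  exists j; first by rewrite W'E xp // mul0r subr0.
  move=> i j'; rewrite !rix p'p => lt le.
  have {}lt : (index p' piv < index i piv)%N.
    by move: lt; case: ifP => // ip _; rewrite (memNindex (negbT ip)) index_mem.
  have pp : (index p' piv < index p piv)%N by rewrite (memNindex pnp) index_mem.
  by rewrite W'E (hj _ _ lt le) (hj _ _ pp le) mulr0 subr0.
move=> i j; rewrite mem_rcons inE negb_or => /andP[ip' ip].
rewrite ltnS leq_eqVlt => /predU1P[/val_inj->|]; first exact: W'c.
exact: W'0.
Qed.


Lemma ctab_mx_cost (X : Type) (a b C : nat) (f : 'I_a -> 'I_b -> counted X) :
  (forall i j, (f i j).1 <= C)%N -> ((ctab_mx f).1 <= a * b * C)%N.
Proof.
move=> fC; have -> : (a * b * C = \sum_(i < a) \sum_(j < b) C)%N.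
  by rewrite !sum_nat_const !card_ord mulnA.
by apply: leq_sum => i _; apply: leq_sum.
Qed.


(** One inversion, one quotient per row, and one multiplication and subtraction
    for each entry of W and of Q. *)
Definition pivot_cost : nat := (1 + (m + (m * n * 2 + m * m * 2)))%N.

(** The zero tests are charged to the column and the row operations to the new
    pivot, because the number of pivots can be bounded by either dimension. *)
Lemma gauss_column_cost (c : 'I_n) (st : 'M[k]_(m, n) * 'M[k]_m * seq 'I_m) :
  ((gauss_column st c).1 + size st.2 * pivot_cost <=
    m + size (gauss_column st c).2.2 * pivot_cost)%N.
Proof.
case: st => [[W Q] piv]; rewrite /gauss_column.
set cand := cfilter _ _.
have lecand : (cand.1 <= m)%N.
  rewrite /cand /= sum1_size size_filter (leq_trans (count_size _ _)) //.
  by rewrite size_enum_ord.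
case: cand lecand => a [|p below] /= lea.
  by rewrite addn0 leq_add2r.
rewrite size_rcons mulSn [X in (_ <= X)%N]addnA leq_add2r leq_add // addn0 /pivot_cost.
rewrite leq_add2l !leq_add //.
- rewrite -[X in (_ <= X)%N]muln1 -[X in (_ <= X * 1)%N]muln1.
  by apply: ctab_mx_cost => i j; case: ifP.
- by apply: ctab_mx_cost => i j; case: ifP.
- by apply: ctab_mx_cost => i j; case: ifP.
Qed.

Lemma gauss_fold (d : nat) (st : 'M[k]_(m, n) * 'M[k]_m * seq 'I_m) :
  (d <= n)%N -> gauss_inv (n - d) st ->
  let r := cfold (@gauss_column k m n) st (drop (n - d) (enum 'I_n)) in
  gauss_inv n r.2 /\
  (r.1 + size st.2 * pivot_cost <= d * m + size r.2.2 * pivot_cost)%N.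
Proof.
elim: d st => [|d IHd] st dn inv.
  by rewrite subn0 drop_oversize ?size_enum_ord //= -[n in gauss_inv n]subn0.
have lt : (n - d.+1 < n)%N by rewrite -subSn // subSS leq_subr.
have eS : (n - d = (n - d.+1).+1)%N by rewrite -subSn // subSS.
rewrite (drop_nth (Ordinal lt)) ?size_enum_ord //=.
set c := nth _ _ _; have ec : c = Ordinal lt.
  by apply: val_inj; rewrite /= nth_enum_ord.
have := gauss_column_inv (c := c) (st := st).
rewrite ec /= -eS => /(_ inv) /(IHd _ (ltnW dn)) [inv' cost]; split=> //.
have := gauss_column_cost (Ordinal lt) st.
move: cost; rewrite mulSn /=; lia.
Qed.

(** P lists the rows of Q, pivots first, so that the rows of P M are those of
    W in the final order, and the pivot columns increase along them.  Solving
    y P M = 0 at the pivot columns one after the other shows that y vanishes on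
    the pivots; hence the kernel is spanned by the last coordinates, and the
    rank is the number of pivots. *)
Lemma gauss_correct :
  let c := (gauss M).1 in let P := (gauss M).2.1 in let s := (gauss M).2.2 in
  [/\ echelon M c P s,
      forall (i : 'I_m) (j : 'I_n), (s <= i)%N -> (P *m M) i j = 0,
      forall y : 'rV_m, y *m (P *m M) = 0 -> forall i : 'I_m, (i < s)%N -> y 0 i = 0
    & (c <= n * m + s * pivot_cost)%N].
Proof.
have inv0 : gauss_inv (n - n) (M, 1%:M, [::]).
  rewrite subnn; split=> //; first by rewrite mul1mx.
  by split=> [i j ij|i]; rewrite !mxE ?eqxx // -val_eqE /= ltn_eqF.
have [inv cost] := gauss_fold (leqnn n) inv0.
move: inv cost; rewrite subnn drop0 /echelon /gauss.
case: (cfold _ _ _) => c0 [[W Q] piv] [eW Qlow upiv hpiv hrest].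
rewrite /cbind /= addn0 => cost.
set rows := piv ++ _; set P := \matrix_(i, j) _.
have urows : uniq rows.
  rewrite cat_uniq upiv filter_uniq ?enum_uniq // andbT.
  by apply/hasPn => i; rewrite mem_filter => /andP[].
have mrows i : i \in rows.
  by rewrite mem_cat mem_filter mem_enum andbT orbN.
have srows : size rows = m.
  by rewrite -[RHS]card_ord -(card_uniqP urows); apply: eq_card.
pose g (i : 'I_m) := nth i rows i.
have gE i j : g i = nth j rows i by apply: set_nth_default; rewrite srows.
have gI : injective g.
  move=> i i'; rewrite (gE i i) (gE i' i) => /eqP.
  by rewrite nth_uniq ?srows // => /eqP/val_inj.
have ixg i : index (g i) rows = i by rewrite /g index_uniq ?srows.
have gpiv (i : 'I_m) : (g i \in piv) = (i < size piv)%N.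
  by rewrite -[X in (X < _)%N]ixg /rows index_cat; case: ifP => ip;
    rewrite ?index_mem ?ip // ltnNge leq_addr.
have ixgp (i i' : 'I_m) : (i < size piv)%N -> (i < i')%N ->
    (index (g i) piv < index (g i') piv)%N.
  move=> ip ii'; have := ixg i; rewrite /rows index_cat gpiv ip => ->.
  have := ixg i'; rewrite /rows index_cat gpiv; case: ifP => [_ ->//|i'p _].
  by rewrite memNindex ?gpiv ?i'p.
have AE i j : (P *m M) i j = W (g i) j.
  by rewrite eW !mxE; apply: eq_bigr => l _; rewrite mxE.
have A0 (i : 'I_m) j : (size piv <= i)%N -> (P *m M) i j = 0.
  by move=> ip; rewrite AE hrest // gpiv -leqNgt.
have lead (i : 'I_m) : (i < size piv)%N -> exists2 j, (P *m M) i j != 0 &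
    forall (i' : 'I_m) (j' : 'I_n), (i < i')%N -> (j' <= j)%N -> (P *m M) i' j' = 0.
  move=> ip; have [|j Wj hj] := hpiv (g i); first by rewrite gpiv.
  exists j; first by rewrite AE.
  by move=> i' j' ii' jj'; rewrite AE; apply: hj; first exact: ixgp.
have ker0 (y : 'rV_m) : y *m (P *m M) = 0 ->
    forall i : 'I_m, (i < size piv)%N -> y 0 i = 0.
  move=> yA0 [i im]; elim/ltn_ind: i im => i IH im /= ip.
  have [j Aj hj] := lead (Ordinal im) ip.
  have /matrixP/(_ 0 j) := yA0; rewrite [LHS]mxE [RHS]mxE (bigD1 (Ordinal im)) //= big1.
    by rewrite addr0 => /eqP; rewrite mulf_eq0 (negPf Aj) orbF => /eqP.
  move=> i'; rewrite -val_eqE /= neq_ltn => /orP[lt|lt].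
    by case: i' lt => i' i'm /= lt; rewrite IH ?mul0r // (ltn_trans lt).
  by rewrite hj ?mulr0.
pose sg := perm gI.
have PQ : P = row_perm sg Q.
  by apply/matrixP => i j; rewrite !mxE permE; congr (Q _ _); apply: gE.
have Qu : Q \in unitmx by rewrite unitmxE (det_unitriangular Qlow) unitr1.
have Pu : P \in unitmx by rewrite PQ row_permE unitmx_mul unitmx_perm.
split=> //; split=> //.
- split=> //; exists (sg^-1)%g; rewrite PQ -row_permM mulVg row_perm1.
  by case: Qlow.
- move=> i i' j' ii' Aj'.
  have i's : (i' < size piv)%N by rewrite ltnNge; apply: contraNN Aj' => /A0->.
  have [j Aj hj] := lead i (ltn_trans ii' i's).
  by exists j => //; rewrite ltnNge; apply: contraNN Aj' => /(hj _ _ ii')->.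
- have sm : (size piv <= m)%N by apply: leq_trans (eq_leq srows); rewrite size_cat leq_addr.
  have rk : \rank M = \rank (P *m M) by rewrite eqmxMfull ?row_full_unit.
  apply/eqP; rewrite eqn_leq rk; apply/andP; split.
    have : (\rank (kermx (P *m M)) <= m - size piv)%N.
      rewrite -(rank_copid_mx k sm) mxrankS //; apply/row_subP => i.
      have /ker0 h : row i (kermx (P *m M)) *m (P *m M) = 0.
        by rewrite -row_mul mulmx_ker row0.
      apply/submxP; exists (row i (kermx (P *m M))).
      rewrite /copid_mx mulmxBr mulmx1; set y := row _ _ in h *.
      suff -> : y *m (pid_mx (size piv) : 'M_m) = 0 by rewrite subr0.
      apply/rowP => j; rewrite [LHS]mxE [RHS]mxE big1 // => l _.
      have [lp|lp] := ltnP l (size piv); first by rewrite h // mul0r.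
      by rewrite [pid_mx _ _ _]mxE [(l < _)%N]ltnNge lp andbF mulr0.
    rewrite mxrank_ker; have := rank_leq_row (P *m M); lia.
  have -> : P *m M = pid_mx (size piv) *m (P *m M).
    apply/matrixP => i j; rewrite [RHS]mxE (bigD1 i) //= big1 ?addr0.
      rewrite [pid_mx _ _ _]mxE eqxx /=.
      by case: ltnP => ip; rewrite ?mul1r // A0 // mulr0.
    move=> l; rewrite eq_sym -val_eqE /= => /negbTE li.
    by rewrite [pid_mx _ _ _]mxE li mul0r.
  by rewrite (leq_trans (mxrankM_maxl _ _)) // rank_pid_mx.
Qed.

End Gauss.

(** * Leading matrices and rounds of replacements *)

Section LeadingMatrix.
Variables (k : fieldType) (n : nat).
Implicit Types (T : 'M[{poly k}]_n) (i j : 'I_n).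

(** This is the matrix M of Stage 1; those of Stage 2 are submatrices of it. *)
Definition leading_mx T : 'M[k]_n := \matrix_(i, j) (T i j)`_(rowN (row i T)).

Lemma size_le_rowN T i j : (size (T i j) <= (rowN (row i T)).+1)%N.
Proof.
rewrite (leq_trans (leqSpred _)) // ltnS /rowN.
by have := leq_bigmax (F := fun j => (size (row i T 0 j)).-1) j; rewrite mxE.
Qed.

Lemma rowN_le T i (N : nat) :
  (forall j, (size (T i j) <= N.+1)%N) -> (rowN (row i T) <= N)%N.
Proof.
move=> le; apply/bigmax_leqP => j _; rewrite mxE.
by case: (size _) (le j).
Qed.

Lemma rowN_eq T i (N : nat) j :
  (forall j, (size (T i j) <= N.+1)%N) -> (T i j)`_N != 0 -> rowN (row i T) = N.
Proof.
move=> le nz; apply/eqP; rewrite eqn_leq rowN_le //=.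
have : (N < size (T i j))%N.
  by rewrite ltnNge; apply: contraNN nz => /leq_sizeP/(_ N (leqnn _))->.
by move/leq_trans/(_ (size_le_rowN T i j)); rewrite ltnS.
Qed.

(** The maximum N(T_i) is the degree of some entry, whose leading coefficient
    appears in the leading row. *)
Lemma leading_row_eq0 T i : (forall j, leading_mx T i j = 0) -> forall j, T i j = 0.
Proof.
move=> l0 j; apply/eqP; apply: contraT => Tj.
have n_gt0 : (0 < #|'I_n|)%N by rewrite card_ord (leq_trans _ (ltn_ord j)).
have [j0 ej0] := @bigop.eq_bigmax _ (fun j : 'I_n => (size (row i T 0 j)).-1) n_gt0.
have := l0 j0; rewrite mxE {1}/rowN ej0 mxE => /eqP.
rewrite -/(lead_coef _) lead_coef_eq0 => /eqP Tj0.
have N0 : rowN (row i T) = 0%N by rewrite /rowN ej0 mxE Tj0 size_poly0.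
have := size_le_rowN T i j; rewrite N0 => /size1_polyC ej.
by move: (l0 j) Tj; rewrite mxE N0 ej coefC /= => -> /eqP[].
Qed.

Lemma lead_mxE (f m : nat) (e : 'I_f -> 'I_n) (g : 'I_m -> 'I_n) T a b :
  lead_mx e g T a b = leading_mx T (e a) (g b).
Proof. by rewrite !mxE zcE ?size_le_rowN. Qed.

End LeadingMatrix.

Section Replacement.
Variables (k : fieldType) (f : nat) (P : 'M[k]_f).
Hypothesis LTP : LT_group P.

(** The rows of P are those of a unitriangular matrix in another order, and a
    unitriangular row has its last nonzero entry, 1, on the diagonal. *)
Lemma last_nzP : exists g : 'S_f, forall i,
  [/\ last_nz P i = g i, P i (g i) = 1 & forall j : 'I_f, (g i < j)%N -> P i j = 0].
Proof.
case: LTP => _ [s [up diag]].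
have PE i j : P i j = row_perm s P ((s^-1)%g i) j by rewrite mxE permKV.
exists (s^-1)%g => i; split; [|by rewrite PE|by move=> j lt; rewrite PE up].
rewrite /last_nz /arg_max /extremum; case: pickP => [j /andP[/= Pj /forallP le]|no].
  apply: val_inj; apply/eqP; rewrite eqn_leq; apply/andP; split.
    by rewrite leqNgt; apply: contraNN Pj => lt; rewrite PE up.
  by have /implyP := le ((s^-1)%g i); apply; rewrite PE diag oner_eq0.
have := no ((s^-1)%g i); rewrite /= PE diag oner_eq0 /= => /forallP[] j.
apply/implyP; apply: contraR; rewrite -ltnNge => lt.
by rewrite PE up.
Qed.

Lemma last_nz_inj : injective (last_nz P).
Proof.
case: last_nzP => g gP i i'; case: (gP i) => -> _ _; case: (gP i') => -> _ _.
exact: perm_inj.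
Qed.

(** The left kernel of M is spanned by the rows i >= s of P.  As their last
    nonzero entries are at distinct places u_i, a combination is nonzero at the
    largest u_i that occurs in it.  Thus the rows of M other than the u_i are
    linearly independent. *)
Lemma kernel_last_nz (m s : nat) (M : 'M[k]_(f, m)) (y : 'rV_f) :
  (forall z : 'rV_f, z *m (P *m M) = 0 -> forall i : 'I_f, (i < s)%N -> z 0 i = 0) ->
  y *m M = 0 -> (forall i : 'I_f, (s <= i)%N -> y 0 (last_nz P i) = 0) -> y = 0.
Proof.
move=> ker yM y0; have Pu : P \in unitmx by case: LTP.
pose z := y *m invmx P; have yE : y = z *m P by rewrite mulmxKV.
have zs : forall i : 'I_f, (i < s)%N -> z 0 i = 0.
  by apply: ker; rewrite mulmxA -yE.
suff z0 : z = 0 by rewrite yE z0 mul0mx.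
apply/rowP => i; rewrite [RHS]mxE; apply/eqP; apply: contraT => zi.
have [g gP] := last_nzP.
(* y = z P is nonzero at the largest u_i' with z_i' nonzero *)
case: (@arg_maxnP _ i (fun i' => z 0 i' != 0) (fun i' => g i') zi) => i' zi' le.
have si' : (s <= i')%N by rewrite leqNgt; apply: contraNN zi' => /zs->.
case/eqP: zi'; have := y0 _ si'; rewrite yE mxE; case: (gP i') => -> Pi' _.
rewrite (bigD1 i') //= Pi' mulr1 big1 ?addr0 // => l li'.
have [->|zl] := eqVneq (z 0 l) 0; first by rewrite mul0r.
have [_ _ ->] := gP l; first by rewrite mulr0.
have {}le : (g l <= g i')%N := le _ zl.
rewrite ltn_neqAle le andbT.
by apply: contraNneq li' => /val_inj/perm_inj->.
Qed.

Variables (n : nat) (e : 'I_f -> 'I_n) (T : 'M[{poly k}]_n) (s : nat).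
Hypothesis e_incr : forall i j : 'I_f, (i < j)%N -> (e i < e j)%N.
Hypothesis e_sorted : forall i j : 'I_f, (i <= j)%N ->
  (rowN (row (e i) T) <= rowN (row (e j) T))%N.
Let N (r : 'I_n) := rowN (row r T).
Let T' := (replace_rows e P s T).2.

Let e_inj : injective e.
Proof.
move=> i j eij; apply/val_inj; case: (ltngtP i j) => // /e_incr;
by rewrite eij ltnn.
Qed.

Definition replaced : {set 'I_n} := [set e (last_nz P i) | i : 'I_f & (s <= i)%N].

Lemma card_replaced : #|replaced| = (f - s)%N.
Proof.
rewrite card_imset; last exact: inj_comp e_inj last_nz_inj.
rewrite -[RHS]muln1 -sum_nat_const_nat big_geq_mkord.
by rewrite sum1dep_card.
Qed.

Lemma replacedP r : reflect (exists2 i : 'I_f, (s <= i)%N & r = e (last_nz P i))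
  (r \in replaced).
Proof.
apply: (iffP imsetP) => [[i]|[i si ->]]; first by rewrite inE; exists i.
by exists i; rewrite ?inE.
Qed.

Lemma cscale_polyE (a : k) p : (cscale_poly a p).2 = a *: p.
Proof.
apply/polyP => i; rewrite coefZ coef_poly; case: ltnP => // le.
by rewrite (leq_sizeP _ _ le) ?mulr0.
Qed.

Lemma cadd_polyE (p q : {poly k}) : (cadd_poly p q).2 = p + q.
Proof.
apply/polyP => i; rewrite coefD coef_poly; case: ltnP => //.
rewrite geq_max => /andP[le1 le2].
by rewrite (leq_sizeP _ _ le1) ?(leq_sizeP _ _ le2) ?addr0.
Qed.

Lemma cscale_poly_cost (a : k) p : (cscale_poly a p).1 = (size p * 2)%N.
Proof. by rewrite /= sum_nat_const card_ord. Qed.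

Lemma cadd_poly_cost (p q : {poly k}) :
  (cadd_poly p q).1 = (maxn (size p) (size q) * 2)%N.
Proof. by rewrite /= sum_nat_const card_ord. Qed.

Lemma new_entryE (p : 'I_f -> k) u c :
  p u = 1 -> (forall j : 'I_f, (u < j)%N -> p j = 0) ->
  (new_entry e T p u c).2 = \sum_j 'X^(N (e u) - N (e j)) * (p j *: T (e j) c).
Proof.
move=> pu p0; rewrite /new_entry.
have -> (acc : {poly k}) l : (cfold (fun (acc : {poly k}) (j : 'I_f) =>
    let! x := cscale_poly (p j) (T (e j) c) in
    cadd_poly acc ('X^(rowN (row (e u) T) - rowN (row (e j) T)) * x)) acc l).2
    = acc + \sum_(j <- l) 'X^(N (e u) - N (e j)) * (p j *: T (e j) c).
  elim: l acc => [|j l IHl] acc; first by rewrite big_nil addr0.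
  rewrite big_cons addrA -cscale_polyE -[acc + _]cadd_polyE.
  exact: IHl.
rewrite big_filter (bigD1 u) //= subnn expr0 mul1r pu scale1r; congr (_ + _).
rewrite big_enum_cond [RHS](bigID (fun j : 'I_f => (j < u)%N)) /=.
rewrite [X in _ = _ + X]big1 ?addr0 => [|j /andP[ju]].
  apply: eq_bigl => j; rewrite -val_eqE /=.
  by case: ltngtP.
rewrite -leqNgt leq_eqVlt => /predU1P[/val_inj uj|/p0->].
  by rewrite uj eqxx in ju.
by rewrite scale0r mulr0.
Qed.

Lemma replace_rows_id r c : r \notin replaced -> T' r c = T r c.
Proof.
move=> rr; rewrite mxE; case: pickP => // i /andP[si /eqP er].
by case/replacedP: rr; exists i.
Qed.

(** The old row T_(e u) is the term j = u of the sum, since p_(i, u) = 1. *)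
Lemma replace_rowsE (i : 'I_f) c : (s <= i)%N -> T' (e (last_nz P i)) c =
  \sum_j 'X^(N (e (last_nz P i)) - N (e j)) * (P i j *: T (e j) c).
Proof.
move=> si; rewrite mxE; case: pickP => [i' /andP[si' /eqP/e_inj/last_nz_inj->]|].
  by case: last_nzP => g /(_ i)[-> Pi P0]; rewrite new_entryE.
by move/(_ i); rewrite si eqxx.
Qed.

Lemma size_replace_rows (i : 'I_f) c : (s <= i)%N ->
  (size (T' (e (last_nz P i)) c) <= (N (e (last_nz P i))).+1)%N.
Proof.
move=> si; rewrite replace_rowsE //.
apply: (leq_trans (size_sum _ _ _)); apply/bigmax_leqP => j _.
case: last_nzP => g /(_ i)[-> _ P0].
have [lt|le] := ltnP (g i) j; first by rewrite P0 // scale0r mulr0 size_poly0.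
have le' := e_sorted le.
rewrite (leq_trans (size_polyMleq _ _)) // size_polyXn addSn /=.
rewrite /N -[X in (_ <= X.+1)%N](subnK le') -addnS leq_add2l.
by rewrite (leq_trans (size_scale_leq _ _)) // size_le_rowN.
Qed.

(** The monomials make the leading terms of all rows meet in the degree
    N(T_(e u)), where their coefficients combine to row i of P M. *)
Lemma coef_replace_rows (i : 'I_f) c : (s <= i)%N ->
  (T' (e (last_nz P i)) c)`_(N (e (last_nz P i))) =
  \sum_j P i j * leading_mx T (e j) c.
Proof.
move=> si; rewrite replace_rowsE // coef_sum; apply: eq_bigr => j _.
case: last_nzP => g /(_ i)[-> _ P0].
have [lt|le] := ltnP (g i) j; first by rewrite P0 // scale0r mulr0 coef0 mul0r.
have le' := e_sorted le.
by rewrite coefXnM coefZ ltnNge leq_subr /= subKn // mxE.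
Qed.

(** A round is multiplication by a unitriangular matrix, because [e] is
    increasing and only rows j <= u contribute to row u.  The coefficients [q]
    are left open: they are monomials for the polynomial rows, and the p_(i, j)
    themselves for the leading rows. *)
Lemma replacement_mx (R : comPzRingType) (q : 'I_f -> 'I_f -> R) :
  (forall i, q i (last_nz P i) = 1) ->
  (forall i j : 'I_f, (last_nz P i < j)%N -> q i j = 0) ->
  exists2 V : 'M[R]_n, \det V = 1 & forall (m : nat) (A : 'M[R]_(n, m)),
    (forall r c, r \notin replaced -> (V *m A) r c = A r c) /\
    (forall (i : 'I_f) c, (s <= i)%N ->
      (V *m A) (e (last_nz P i)) c = \sum_j q i j * A (e j) c).
Proof.
move=> q1 q0.
pose V : 'M[R]_n := \matrix_(r, r') if r \in replaced then
  \sum_(i : 'I_f | (s <= i)%N && (e (last_nz P i) == r))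
    \sum_(j : 'I_f | e j == r') q i j else (r == r')%:R.
have VE (i : 'I_f) r' : (s <= i)%N ->
    V (e (last_nz P i)) r' = \sum_(j : 'I_f | e j == r') q i j.
  move=> si; rewrite mxE; case: replacedP => [_|[]]; last by exists i.
  rewrite (big_pred1 i) // => i' /=; rewrite (inj_eq e_inj) (inj_eq last_nz_inj).
  by rewrite andb_idl // => /eqP->.
exists V => [|m A].
  apply: det_unitriangular; split=> [r r' lt|r].
    have [/replacedP[i si er]|nr] := boolP (r \in replaced); last first.
      by rewrite mxE (negPf nr) -val_eqE /= ltn_eqF.
    move: lt; rewrite er VE // => lt; rewrite big1 // => j /eqP ej.
    rewrite -ej in lt; apply: q0; rewrite ltnNge leq_eqVlt negb_or; apply/andP; split.
      by apply: contraTneq lt => /val_inj->; rewrite ltnn.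
    by apply/negP => /e_incr lt'; move: (ltn_trans lt lt'); rewrite ltnn.
  have [/replacedP[i si ->]|nr] := boolP (r \in replaced); last first.
    by rewrite mxE (negPf nr) eqxx.
  by rewrite VE // (big_pred1 (last_nz P i)) => // j; rewrite /= (inj_eq e_inj).
split=> [r c nr|i c si]; rewrite mxE.
  rewrite (bigD1 r) //= big1 ?addr0.
    by rewrite mxE (negPf nr) eqxx mul1r.
  by move=> r' /negbTE rr'; rewrite mxE (negPf nr) eq_sym rr' mul0r.
under eq_bigr => r' _ do rewrite VE // mulr_suml.
rewrite (exchange_big_dep xpredT) //=; apply: eq_bigr => j _.
by rewrite (big_pred1 (e j)) => [|r'] //=; rewrite eq_sym.
Qed.

Lemma replace_rows_mul : exists2 V : 'M[{poly k}]_n, \det V = 1 & T' = V *m T.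
Proof.
have [i|i j lt|V V1 /(_ _ T)[Vid VE]] := @replacement_mx _
  (fun i j => (P i j)%:P * 'X^(N (e (last_nz P i)) - N (e j))).
- by rewrite subnn mulr1; case: last_nzP => g /(_ i)[-> -> _].
- by move: lt; case: last_nzP => g /(_ i)[-> _ P0] /P0->; rewrite mul0r.
exists V => //; apply/matrixP => r c.
have [/replacedP[i si ->]|nr] := boolP (r \in replaced); last first.
  by rewrite Vid // replace_rows_id.
rewrite VE // replace_rowsE //; apply: eq_bigr => j _.
by rewrite -mul_polyC mulrA [_ * _%:P]mulrC.
Qed.

(** All polynomials that occur have degree at most N(T_(e u)), so that each of
    the at most f terms needs 2 (H + 1) operations for the scalar multiple and
    as many for the sum, zero tests included. *)
Lemma new_entry_cost (H : nat) (p : 'I_f -> k) u c :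
  (forall r, (N r <= H)%N) -> ((new_entry e T p u c).1 <= f * (4 * H.+1))%N.
Proof.
move=> NH; rewrite /new_entry; set l := filter _ _.
have sl : (size l <= f)%N.
  by rewrite size_filter (leq_trans (count_size _ _)) // size_enum_ord.
have lu : all (fun j : 'I_f => (j < u)%N) l by apply: filter_all.
rewrite (leq_trans _ (leq_mul sl (leqnn _))) //.
have: (size (T (e u) c) <= (N (e u)).+1)%N by exact: size_le_rowN.
elim: l lu (T (e u) c) {sl} => // j l IHl /andP[ju lu] acc sacc.
set x := (cscale_poly (p j) (T (e j) c)).2.
have sx : (size x <= (N (e j)).+1)%N.
  by rewrite /x cscale_polyE (leq_trans (size_scale_leq _ _)) // size_le_rowN.
have {}sx : (size ('X^(N (e u) - N (e j)) * x)%R <= (N (e u)).+1)%N.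
  rewrite (leq_trans (size_polyMleq _ _)) // size_polyXn addSn /=.
  by rewrite /N -[X in (_ <= X.+1)%N](subnK (e_sorted (ltnW ju))) -addnS leq_add2l.
rewrite [size _]/= mulSn; apply: leq_add; last first.
  apply: IHl => //; set q := 'X^_ * x in sx.
  suff: (size (cadd_poly acc q).2 <= (N (e u)).+1)%N by [].
  by rewrite cadd_polyE (leq_trans (size_polyD _ _)) // geq_max sacc.
have -> : (4 * H.+1 = H.+1 * 2 + H.+1 * 2)%N by lia.
set q := 'X^_ * x in sx.
suff: ((cscale_poly (p j) (T (e j) c)).1 + (cadd_poly acc q).1 <=
  H.+1 * 2 + H.+1 * 2)%N by [].
rewrite cscale_poly_cost cadd_poly_cost leq_add // leq_mul2r /=.
  by rewrite (leq_trans (size_le_rowN _ _ _)) // ltnS NH.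
have NuH : ((N (e u)).+1 <= H.+1)%N by rewrite ltnS.
by rewrite geq_max (leq_trans sacc NuH) (leq_trans sx NuH).
Qed.

Lemma replace_rows_cost (H : nat) : (forall r, (N r <= H)%N) ->
  ((replace_rows e P s T).1 <= #|replaced| * (f + n * (f * (4 * H.+1))))%N.
Proof.
move=> NH; rewrite /replace_rows /cbind /= mulnDr leq_add //.
  rewrite card_replaced.
  rewrite (eq_bigr (fun i : 'I_f => if (s <= i)%N then f else 0%N)); last first.
    move=> i _; case: ifP => _; rewrite sum_nat_const card_ord ?muln1 //.
    by rewrite muln0.
  rewrite -big_mkcond /= sum_nat_const leq_mul2r.
  by rewrite -card_replaced /replaced card_imset ?cardsE ?leqnn ?orbT //;
     exact: inj_comp e_inj last_nz_inj.
rewrite mulnA -mulnA -sum_nat_const [X in (_ <= X)%N]big_mkcond /=.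
apply: leq_sum => r _; rewrite -[n in (n * _)%N]card_ord.
case: ifP => rr; last first.
  rewrite big1 // => c _; case: pickP => // i /andP[si /eqP er].
  by case/negP: (negbT rr); apply/replacedP; exists i.
rewrite -sum_nat_const; apply: leq_sum => c _; case: pickP => // i _.
exact: new_entry_cost.
Qed.

End Replacement.

(** * Stage 1 *)

Section Sorting.
Variables (k : fieldType) (n : nat) (le : rel 'rV[{poly k}]_n).
Hypotheses (le_total : total le) (le_trans : transitive le).

Lemma sort_rowsP T : exists g : 'S_n, sort_rows le T = row_perm g T.
Proof.
pose t := [tuple row j T | j < n].
have /tuple_permP[g eg] : perm_eq (sort le t) t by rewrite perm_sort.
exists g; apply/row_matrixP => i; rewrite rowK row_permEsub row_rowsub.
rewrite -[X in sort le X]/(val t) eg.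
by rewrite (nth_map i) ?size_enum_ord // nth_ord_enum tnth_mktuple.
Qed.

Lemma sort_rows_sorted T (i j : 'I_n) : (i <= j)%N ->
  le (row i (sort_rows le T)) (row j (sort_rows le T)).
Proof.
move=> ij; rewrite !rowK; apply: sorted_leq_nth => //.
- by move=> x; have := le_total x x; rewrite orbb.
- exact: sort_sorted.
- by rewrite inE size_sort size_map size_enum_ord.
- by rewrite inE size_sort size_map size_enum_ord.
Qed.

End Sorting.

Section Stage1.
Variables (k : fieldType) (n : nat).
Implicit Types (T U : 'M[{poly k}]_n).

Definition unimodular_to T U : Prop := exists2 V, V \in unitmx & U = V *m T.

Lemma unimodular_refl T : unimodular_to T T.
Proof. by exists 1%:M; rewrite ?unitmx1 ?mul1mx. Qed.

Lemma unimodular_trans T U W :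
  unimodular_to T U -> unimodular_to U W -> unimodular_to T W.
Proof.
by case=> V Vu -> [V' V'u ->]; exists (V' *m V); rewrite ?unitmx_mul ?V'u ?Vu ?mulmxA.
Qed.

Lemma unimodular_perm (g : 'S_n) T : unimodular_to T (row_perm g T).
Proof. by exists (perm_mx g); rewrite ?unitmx_perm ?row_permE. Qed.

Lemma unimodular_det_neq0 T U : unimodular_to T U -> \det T != 0 -> \det U != 0.
Proof.
case=> V Vu -> T0; rewrite det_mulmx mulf_neq0 //.
by move: Vu; rewrite unitmxE; apply: contraTneq => ->; rewrite unitr0.
Qed.

Lemma det_neq0_row T r : \det T != 0 -> exists j, T r j != 0.
Proof.
move=> d; apply/existsP; apply: contraR d; rewrite negb_exists => /forallP h.
rewrite (expand_det_row _ r) big1 // => j _.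
by have := h j; rewrite negbK => /eqP->; rewrite mul0r.
Qed.

Lemma det_neq0_leading_row T r : \det T != 0 -> exists j, leading_mx T r j != 0.
Proof.
move=> /(@det_neq0_row _ r)[j Tj]; apply/existsP; apply: contraR Tj.
rewrite negb_exists => /forallP h.
have h0 j' : leading_mx T r j' = 0 by have := h j'; rewrite negbK => /eqP.
by apply/eqP; apply: leading_row_eq0.
Qed.

Definition total_degree T : nat := \sum_i rowN (row i T).

Lemma rowN_perm g T i : rowN (row i (row_perm g T)) = rowN (row (g i) T).
Proof. by rewrite row_permEsub row_rowsub. Qed.

Lemma total_degree_perm g T : total_degree (row_perm g T) = total_degree T.
Proof.
rewrite /total_degree [RHS](reindex_inj (@perm_inj _ g)) /=.
by apply: eq_bigr => i _; rewrite rowN_perm.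
Qed.

Lemma leading_perm g T : leading_mx (row_perm g T) = row_perm g (leading_mx T).
Proof. by apply/matrixP => i j; rewrite !mxE rowN_perm. Qed.

(** The bound is linear in the number of columns: the classes have n columns in
    total, so that one elimination for each class costs O(n^3) altogether. *)
Lemma gauss_cost (f m : nat) (M : 'M[k]_(f, m)) c P s :
  (f <= n)%N -> (m <= n)%N -> echelon M c P s -> (c <= m * (7 * n ^ 2))%N.
Proof.
move=> fn mn [eg _ _ es].
have [_ _ _] := gauss_correct M; rewrite eg /= /pivot_cost.
have : (s <= m)%N by rewrite es rank_leq_col.
have : (s <= f)%N by rewrite es rank_leq_row.
move=> sf sm /leq_trans; apply.
have [m0|m_gt0] := posnP m; first by move: sm; rewrite m0 leqn0 => /eqP->; rewrite !mul0n.
have n_gt0 : (0 < n)%N by exact: leq_trans mn.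
have -> : (m * (7 * n ^ 2) = m * n ^ 2 + m * (6 * n ^ 2))%N by lia.
apply: leq_add; first by rewrite leq_mul2l expnS expn1 (leq_trans fn) ?leq_pmulr ?orbT.
have [f0|f_gt0] := posnP f; first by move: sf; rewrite f0 leqn0 => /eqP->; rewrite !mul0n.
rewrite leq_mul //.
have -> : (6 * n ^ 2 = n ^ 2 + (n ^ 2 + (n ^ 2 * 2 + n ^ 2 * 2)))%N by lia.
have nn a b : (a <= n)%N -> (b <= n)%N -> (a * b <= n ^ 2)%N.
  by move=> an bn; rewrite expnS expn1 leq_mul.
rewrite !leq_add ?leq_mul2r ?nn ?orbT //.
  by rewrite expn_gt0 n_gt0.
by rewrite -[f]muln1 nn.
Qed.

Lemma replace_cost (f : nat) (e : 'I_f -> 'I_n) (P : 'M[k]_f) T (s H : nat) :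
  LT_group P -> (forall i j : 'I_f, (i < j)%N -> (e i < e j)%N) ->
  (forall i j : 'I_f, (i <= j)%N ->
    (rowN (row (e i) T) <= rowN (row (e j) T))%N) ->
  (f <= n)%N -> (forall r, (rowN (row r T) <= H)%N) ->
  ((replace_rows e P s T).1 <= (f - s) * (5 * n ^ 2 * H.+1))%N.
Proof.
move=> LT ei es fn NH.
apply: (leq_trans (replace_rows_cost LT s ei es NH)).
rewrite card_replaced // leq_mul2l; apply/orP; right.
have [f0|f_gt0] := posnP f; first by rewrite f0 mul0n muln0.
have n_gt0 : (0 < n)%N by exact: leq_trans fn.
have -> : (5 * n ^ 2 * H.+1 = n ^ 2 * H.+1 + n * (n * (4 * H.+1)))%N by lia.
rewrite leq_add //; last by rewrite leq_mul2l leq_mul2r fn !orbT.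
rewrite (leq_trans fn) // expnS expn1 -[X in (X <= _)%N]muln1 -mulnA leq_mul //.
by rewrite muln_gt0 n_gt0.
Qed.

Let le_rowN : rel 'rV[{poly k}]_n := fun a b => (rowN a <= rowN b)%N.

(** The new rows have leading coefficients P M = 0 in every column, so their
    degrees drop; as T stays invertible, this is impossible once N = 0. *)
Lemma stage1_round T (H : nat) : \det T != 0 ->
  (forall r, (rowN (row r T) <= H)%N) ->
  let T0 := sort_rows le_rowN T in
  let M := lead_mx id id T0 in
  let P := (gauss M).2.1 in let s := (gauss M).2.2 in
  let T' := (replace_rows id P s T0).2 in
  [/\ echelon M (gauss M).1 P s,
    ((replace_rows id P s T0).1 <= (n - s) * (5 * n ^ 2 * H.+1))%N,
    [/\ \det T' != 0, forall r, (rowN (row r T') <= H)%N,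
      unimodular_to T T' & (total_degree T' + (n - s) <= total_degree T)%N],
    (s <= n)%N &
    (n <= s)%N -> leading_mx T' \in unitmx].
Proof.
move=> T_det NH T0 M P s T'.
have [ech PM0 _ _] := gauss_correct M; rewrite -/P -/s in ech PM0.
have [_ LT _ es] := ech.
have [g eT0] : exists g : 'S_n, T0 = row_perm g T by exact: sort_rowsP.
have T0s (i j : 'I_n) : (i <= j)%N -> (rowN (row i T0) <= rowN (row j T0))%N.
  apply: (@sort_rows_sorted _ _ le_rowN); first by move=> a b; apply: leq_total.
  by move=> a b c; apply: leq_trans.
have NH0 r : (rowN (row r T0) <= H)%N by rewrite eT0 rowN_perm.
have [V V1 eV] := replace_rows_mul LT (e := id) T0 s (fun _ _ => id).
have uT' : unimodular_to T T'.
  apply: (unimodular_trans (unimodular_perm g T)); rewrite -eT0.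
  by exists V => //; rewrite unitmxE V1 unitr1.
have T'_det := unimodular_det_neq0 uT' T_det.
have T'r r : (rowN (row r T') + (r \in replaced P id s) <= rowN (row r T0))%N.
  have [/replacedP[i si er]|nr] := boolP (r \in _); last first.
    rewrite addn0; apply: rowN_le => c.
    by rewrite /T' replace_rows_id // size_le_rowN.
  have T'0 c : (T' r c)`_(rowN (row r T0)) = 0.
    rewrite er coef_replace_rows // -[RHS](PM0 i c si) mxE.
    by apply: eq_bigr => j _; rewrite /M lead_mxE.
  have T's c : (size (T' r c) <= rowN (row r T0))%N.
    apply/leq_sizeP => j; rewrite leq_eqVlt => /predU1P[<-//|lt].
    have sz : (size (T' r c) <= (rowN (row r T0)).+1)%N.
      by rewrite er; apply: size_replace_rows.
    exact: (leq_sizeP _ _ sz).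
  rewrite addn1; case: (posnP (rowN (row r T0))) => [N0|N_gt0].
    have [j] := det_neq0_row r T'_det.
    by have := T's j; rewrite N0 leqn0 size_poly_eq0 => ->.
  by rewrite -(prednK N_gt0) ltnS; apply: rowN_le => c; rewrite prednK.
split=> //.
- by apply: (replace_cost (e := id)).
- split=> // [r|].
    by rewrite (leq_trans (leq_addr _ _) (leq_trans (T'r r) _)).
  rewrite -(total_degree_perm g T) -eT0 -(card_replaced LT (e := id)) //.
  by rewrite -sum1_card big_mkcond -big_split leq_sum.
- by rewrite es rank_leq_row.
- move=> ns; have -> : T' = T0.
    apply/matrixP => r c; rewrite /T' replace_rows_id //.
    apply/negP => /replacedP[i si _]; have := leq_ltn_trans si (ltn_ord i).
    by rewrite ltnNge ns.
  have eM : M = leading_mx T0 by apply/matrixP => i j; rewrite /M lead_mxE.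
  by rewrite -row_free_unit /row_free -eM -es eqn_leq ns es rank_leq_row.
Qed.

(** Elimination is a function, so that a run of the loop has no choice. *)
Lemma stage1_inv T s c U : stage1 s T c U ->
  let T0 := sort_rows le_rowN T in
  let g := gauss (lead_mx id id T0) in
  let r := replace_rows id g.2.1 g.2.2 T0 in
  if (s < n)%N then
    exists2 c3, c = (g.1 + r.1 + c3)%N & stage1 g.2.2 r.2 c3 U
  else c = 0%N /\ U = T.
Proof.
case=> [{}s {}T /negbTE-> //|{}s {}T c1 P s' c2 T' c3 {}U -> T0 [eg _ _ _] er run].
move=> T0' g r; have -> : r = (c2, T') by rewrite -er /r /g /T0' -/T0 eg.
by rewrite /g /T0' -/T0 eg; exists c3.
Qed.

(** Induction on the sum of the N(T_i): a round of rank s < n lowers it by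
    the number n - s > 0 of replaced rows, which also pays for the elimination. *)
Lemma stage1_spec (H : nat) T s : \det T != 0 ->
  (forall r, (rowN (row r T) <= H)%N) -> ((n <= s)%N -> leading_mx T \in unitmx) ->
  (exists c U, stage1 s T c U) /\
  forall c U, stage1 s T c U ->
   [/\ (c <= 7 * n ^ 3 + (7 * n ^ 3 + 5 * n ^ 2 * H.+1) * total_degree T)%N,
     unimodular_to T U, forall r, (rowN (row r U) <= H)%N &
     leading_mx U \in unitmx].
Proof.
have [d] := ubnP (total_degree T); elim: d T s => // d IHd T s /ltnSE Td.
move=> T_det NH sT.
have [ech c2 [T'_det T'H uT' T'd] sn sn'] := stage1_round T_det NH.
move: ech c2 T'_det T'H uT' T'd sn sn'.
set T0 := sort_rows _ _; set M := lead_mx _ _ _.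
set c1 := (gauss M).1; set P := (gauss M).2.1; set s' := (gauss M).2.2.
set rr := replace_rows _ _ _ _ => ech c2 T'_det T'H uT' T'd s'n sn'.
have c1_le : (c1 <= 7 * n ^ 3)%N.
  by rewrite (leq_trans (gauss_cost _ _ ech)) // mulnCA -expnS.
have [sn|ns] := ltnP s n; last first.
  split=> [|c U run].
    by exists 0%N, T; apply: Stage1_end; rewrite -leqNgt.
  have := stage1_inv run; rewrite /= ltnNge ns /= => -[-> ->].
  by split=> //; [exact: unimodular_refl|exact: sT].
have next : (exists c U, stage1 s' rr.2 c U) /\ forall c U, stage1 s' rr.2 c U ->
    [/\ (rr.1 + c <= (7 * n ^ 3 + 5 * n ^ 2 * H.+1) * total_degree T)%N,
      unimodular_to T U, forall r, (rowN (row r U) <= H)%N & leading_mx U \in unitmx].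
  have [s'_lt|s'_ge] := ltnP s' n; last first.
    split=> [|c U run].
      by exists 0%N, rr.2; apply: Stage1_end; rewrite -leqNgt.
    have := stage1_inv run; cbv zeta; rewrite ltnNge s'_ge => -[-> ->].
    split=> //; last exact: sn'.
    by move: c2; rewrite (eqP s'_ge) mul0n leqn0 => /eqP->.
  have d' : (total_degree rr.2 < d)%N.
    rewrite (leq_trans _ Td) // (leq_trans _ T'd) // -[X in (X < _)%N]addn0.
    by rewrite ltn_add2l subn_gt0.
  have [ex all] := IHd _ s' d' T'_det T'H sn'; split=> // c U run.
  have [c_le uU UH Ul] := all c U run; split=> //; first last.
    exact: unimodular_trans uT' uU.
  have D_gt0 : (0 < n - s')%N by rewrite subn_gt0.
  rewrite (leq_trans _ (leq_mul (leqnn _) T'd)) // mulnDr addnC.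
  rewrite (leq_trans (leq_add c_le c2)) // addnAC addnC leq_add //.
  by rewrite mulnDl leq_add ?leq_pmulr // mulnC.
case: next => [[c [U run]] all]; split.
  exists (c1 + rr.1 + c)%N, U; apply: (Stage1_round sn ech _ run).
  exact: surjective_pairing.
move=> {run}c {}U run; have := stage1_inv run.
cbv zeta; rewrite sn => -[c3 -> /all[c3_le uU UH Ul]]; split=> //.
by rewrite -addnA leq_add.
Qed.

End Stage1.

(** * Classes of rows modulo the integers, and one round of Stage 2 *)

Section RowClasses.
Variables (R : realType) (k : fieldType) (n : nat) (w : 'I_n -> R).
Hypothesis w_bounds : forall j, -1 < w j <= 0.
Implicit Types (T U : 'M[{poly k}]_n) (v : R).

(** The length r_l such that the norm of row i is N(T_i) + r_l. *)
Definition row_residue T i : R := residue w (row i T).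

(** The lengths lie in ]-1, 0], so an entry of degree less than N cannot compete
    with one of degree N: only columns with a nonzero leading coefficient
    matter. *)
Lemma row_normE T i : (exists j, leading_mx T i j != 0) ->
  exists j, [/\ leading_mx T i j != 0,
    forall j', leading_mx T i j' != 0 -> w j' <= w j &
    row_norm w (row i T) = ((rowN (row i T))%:R + w j)%:E].
Proof.
case=> j0 lj0; pose j := [arg max_(j > j0 | leading_mx T i j != 0) w j]%O.
have [lj jmax] : leading_mx T i j != 0 /\
    forall j', leading_mx T i j' != 0 -> w j' <= w j.
  by rewrite /j; case: Order.TotalTheory.arg_maxP.
exists j; split=> //; apply/le_anti/andP; split.
  apply/bigmax_leP; split=> [|j' _]; first exact: leNye.
  rewrite mxE; have [->|Tj'] := eqVneq (T i j') 0.
    by rewrite tofrac0 degR0 leNye.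
  rewrite degR_tofrac // lee_fin.
  have := size_le_rowN T i j'; set N := rowN _.
  rewrite leq_eqVlt => /predU1P[sz|].
    have lj' : leading_mx T i j' != 0.
      by rewrite mxE -/N -[N]/(N.+1.-1) -sz -/(lead_coef _) lead_coef_eq0.
    by rewrite sz lerD2l jmax.
  rewrite ltnS => lt.
  have /andP[_ w'0] := w_bounds j'; have /andP[w1 _] := w_bounds j.
  have : ((size (T i j')).-1%:R + 1 <= N%:R :> R).
    by rewrite natr1 prednK ?ler_nat ?size_poly_gt0.
  lra.
apply: le_trans (le_bigmax _ _ j); rewrite mxE.
have Tj : T i j != 0 by apply: contraNneq lj => Tj; rewrite mxE Tj coef0.
rewrite degR_tofrac // lee_fin lerD2r ler_nat -ltnS prednK ?size_poly_gt0 //.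
rewrite ltnNge; apply: contraNN lj => /leq_sizeP le0.
by rewrite mxE le0.
Qed.

Lemma row_residueP T i : (exists j, leading_mx T i j != 0) ->
  [/\ exists2 j, leading_mx T i j != 0 & row_residue T i = w j,
    forall j, leading_mx T i j != 0 -> w j <= row_residue T i &
    row_norm w (row i T) = ((rowN (row i T))%:R + row_residue T i)%:E].
Proof.
case/row_normE => j [lj jmax en]; have er : row_residue T i = w j.
  by rewrite /row_residue /residue en /= addrC addKr.
by split; rewrite ?er //; exists j.
Qed.

(** Numbers in ]-1, 0] differ by less than 1. *)
Lemma eqmodZ_w i j : eqmodZ (w i) (w j) = (w i == w j).
Proof.
apply/idP/eqP => [/intrP[z ez]|->]; last by rewrite /eqmodZ subrr int_num0.
have /andP[i1 i0] := w_bounds i; have /andP[j1 j0] := w_bounds j.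
have z1 : (z < 1)%R by rewrite -(ltr_int R) -ez; lra.
have z0 : (-1 < z)%R by rewrite -(ltr_int R) -ez; lra.
have e0 : z = 0 by lia.
by apply/eqP; rewrite -subr_eq0 ez e0.
Qed.

Lemma mem_lens v : reflect (exists j, v = w j) (v \in lens w).
Proof.
rewrite mem_sort mem_undup; apply: (iffP mapP) => [[j _]|[j]] ->; exists j => //.
by rewrite mem_enum.
Qed.

Lemma uniq_lens : uniq (lens w).
Proof. by rewrite sort_uniq undup_uniq. Qed.

Lemma class_of_w j : class_of w (w j) = w j.
Proof.
have h : has (eqmodZ (w j)) (lens w).
  by apply/hasP; exists (w j); [apply/mem_lens; exists j|rewrite eqmodZ_w].
have := nth_find 0 h; rewrite /class_of.
have /mem_lens[j' ->] : (lens w)`_(find (eqmodZ (w j)) (lens w)) \in lens w.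
  by rewrite mem_nth // -has_find.
by rewrite eqmodZ_w => /eqP.
Qed.

Lemma leading_row_neq0 T i : leading_mx T \in unitmx -> exists j, leading_mx T i j != 0.
Proof.
move=> u; apply/existsP; apply: contraTT u; rewrite negb_exists => /forallP h.
rewrite unitmxE (expand_det_row _ i) big1 ?unitr0 // => j _.
by have := h j; rewrite negbK => /eqP->; rewrite mul0r.
Qed.

Lemma class_rowsE T j : leading_mx T \in unitmx ->
  class_rows w (w j) T = [seq i <- enum 'I_n | row_residue T i == w j].
Proof.
move=> u; apply: eq_filter => i.
have [[j' _ er] _ ->] := row_residueP (leading_row_neq0 i u).
rewrite er -eqmodZ_w /eqmodZ /= -addrA.
by rewrite rpredDl // natr_int.
Qed.

(** Coefficient vectors are indexed by all rows, with support in the class v: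
    this avoids matrices whose size depends on T, and makes independence
    insensitive to the order of the rows. *)
Definition class_indep v T : Prop := forall x : 'I_n -> k,
  (forall i, row_residue T i != v -> x i = 0) ->
  (forall j, w j = v -> \sum_i x i * leading_mx T i j = 0) -> forall i, x i = 0.

Lemma row_residue_perm g T i : row_residue (row_perm g T) i = row_residue T (g i).
Proof. by rewrite /row_residue row_permEsub row_rowsub. Qed.

Lemma class_indep_perm g v T : class_indep v T -> class_indep v (row_perm g T).
Proof.
move=> ind x x0 xs i; have := ind (fun i => x (g^-1%g i)) _ _ (g i).
rewrite permK; apply=> [i'|j wj].
  by rewrite -{1}[i'](permKV g) -row_residue_perm; apply: x0.
rewrite -[RHS](xs j wj) [LHS](reindex_inj (@perm_inj _ g)) /=.
apply: eq_bigr => i' _; rewrite permK; congr (_ * _).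
by rewrite leading_perm [RHS]mxE.
Qed.

Lemma class_indep_empty v T :
  leading_mx T \in unitmx -> (forall j, w j != v) -> class_indep v T.
Proof.
move=> u wv x x0 _ i; apply: x0.
by have [[j _ ->] _ _] := row_residueP (leading_row_neq0 i u).
Qed.

Section Round.
Variables (T : 'M[{poly k}]_n) (j0 : 'I_n).
Hypothesis T_reg : leading_mx T \in unitmx.
Let v := w j0.
Let rows := class_rows w v T.
Let cols := columns w v.
Let e := tnth (in_tuple rows).
Let g := tnth (in_tuple cols).
Let M := lead_mx e g T.

Lemma mem_rows i : (i \in rows) = (row_residue T i == v).
Proof. by rewrite /rows class_rowsE // mem_filter mem_enum andbT. Qed.

Lemma mem_cols j : (j \in cols) = (w j == v).
Proof. by rewrite mem_filter mem_enum andbT. Qed.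

Lemma uniq_rows : uniq rows.
Proof. by rewrite filter_uniq ?enum_uniq. Qed.

Lemma size_rows : (size rows <= n)%N.
Proof. by rewrite size_filter (leq_trans (count_size _ _)) // size_enum_ord. Qed.

Lemma size_cols : (size cols <= n)%N.
Proof. by rewrite size_filter (leq_trans (count_size _ _)) // size_enum_ord. Qed.

Lemma class_row_residue a : row_residue T (e a) = v.
Proof. by apply/eqP; rewrite -mem_rows mem_tnth. Qed.

Lemma e_surj i : row_residue T i = v -> exists a, i = e a.
Proof. by move/eqP; rewrite -mem_rows => /(tnthP (in_tuple rows)). Qed.

Lemma g_w b : w (g b) = v.
Proof. by apply/eqP; rewrite -mem_cols mem_tnth. Qed.

Lemma g_surj j : w j = v -> exists b, j = g b.
Proof. by move/eqP; rewrite -mem_cols => /(tnthP (in_tuple cols)). Qed.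

Lemma e_increasing (a b : 'I_(size rows)) : (a < b)%N -> (e a < e b)%N.
Proof.
have srt : sorted ltn [seq val i | i <- rows].
  apply: (subseq_sorted ltn_trans) (iota_ltn_sorted 0 n).
  by rewrite -val_enum_ord; apply/map_subseq/filter_subseq.
move=> ab; rewrite /e !(tnth_nth (e a)) /=.
rewrite -!(nth_map _ 0%N (fun i : 'I_n => val i)) //.
by apply: (sorted_ltn_nth ltn_trans) => //; rewrite inE size_map.
Qed.

Lemma e_injective : injective e.
Proof. by apply/tuple_uniqP; apply: uniq_rows. Qed.

Lemma sum_rows (x : 'I_n -> k) (F : 'I_n -> k) :
  (forall i, row_residue T i != v -> x i = 0) ->
  \sum_i x i * F i = \sum_a x (e a) * F (e a).
Proof.
move=> x0; rewrite (bigID (fun i => i \in rows)) /= [X in _ + X]big1 ?addr0.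
  by rewrite -big_uniq ?uniq_rows // big_tnth.
by move=> i; rewrite mem_rows => /x0->; rewrite mul0r.
Qed.

Lemma rank_class_indep : \rank M = size rows <-> class_indep v T.
Proof.
split=> [rk x x0 xs i|ind].
  have free : row_free M by rewrite /row_free rk.
  have [/e_surj[a ->]|/eqP] := pselect (row_residue T i = v); last exact: x0.
  suff /rowP/(_ a) : \row_a x (e a) = 0 by rewrite !mxE.
  apply/eqP; rewrite -(mulmx_free_eq0 _ free); apply/eqP/rowP => b.
  rewrite [LHS]mxE [RHS]mxE -[RHS](xs (g b) (g_w b)) (sum_rows _ x0).
  by apply: eq_bigr => a' _; rewrite /M lead_mxE mxE.
apply/eqP; rewrite -/(row_free M) -kermx_eq0; apply/eqP/row_matrixP => r.
rewrite row0; set y := row r _.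
have yM : y *m M = 0 by rewrite /y -row_mul mulmx_ker row0.
pose x i := \sum_(a | e a == i) y 0 a.
have xe a : x (e a) = y 0 a.
  by rewrite /x (big_pred1 a) // => a'; rewrite /= (inj_eq e_injective).
have x0 i : row_residue T i != v -> x i = 0.
  by move=> ri; rewrite /x big1 // => a /eqP ea; rewrite -ea class_row_residue eqxx in ri.
apply/rowP => a; rewrite [RHS]mxE -xe; apply: ind => // j /g_surj[b ->].
rewrite (sum_rows _ x0); have /rowP/(_ b) := yM.
rewrite [LHS]mxE [RHS]mxE => yMb; rewrite -[RHS]yMb; apply: eq_bigr => a' _.
by rewrite xe /M lead_mxE.
Qed.

Hypothesis T_sorted : forall i j : 'I_n, (i <= j)%N ->
  (rowN (row i T) <= rowN (row j T))%N.
Let P := (gauss M).2.1.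
Let s := (gauss M).2.2.
Let T' := (replace_rows e P s T).2.
Let D := replaced P e s.

Lemma e_sorted (a b : 'I_(size rows)) : (a <= b)%N ->
  (rowN (row (e a) T) <= rowN (row (e b) T))%N.
Proof.
rewrite leq_eqVlt => /predU1P[/val_inj->//|/e_increasing/ltnW].
exact: T_sorted.
Qed.

Let ech : echelon M (gauss M).1 P s.
Proof. by have [] := gauss_correct M. Qed.

Let LT : LT_group P. Proof. by case: ech. Qed.

(** The product of the leading matrix with a unitriangular matrix over k is
    invertible, so that none of its rows is zero.  For this reason the degrees
    N(T_i) cannot drop, and the product is the new leading matrix. *)
Lemma replace_leading_mx : exists L : 'M[k]_n,
  [/\ \det L = 1, leading_mx T' = L *m leading_mx T &
    forall r, rowN (row r T') = rowN (row r T)].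
Proof.
have [a|a b lt|L L1 /(_ _ (leading_mx T))[Lid LE]] :=
  @replacement_mx _ _ _ LT _ e s e_increasing k (fun a b => P a b).
- by have [p /(_ a)[-> ->]] := last_nzP LT.
- by have [p /(_ a)[ea _ P0]] := last_nzP LT; rewrite P0 // -ea.
exists L; 
have Lu : L *m leading_mx T \in unitmx.
  by rewrite unitmx_mul T_reg unitmxE L1 unitr1.
have key r c : (T' r c)`_(rowN (row r T)) = (L *m leading_mx T) r c /\
    (size (T' r c) <= (rowN (row r T)).+1)%N.
  have [/(replacedP P e s)[a sa ->]|nr] := boolP (r \in D).
    rewrite LE // /T' coef_replace_rows //; [|exact: e_increasing|exact: e_sorted].
    by split=> //; apply: size_replace_rows => //; [exact: e_increasing|exact: e_sorted].
  by rewrite Lid // /T' replace_rows_id // mxE; split=> //; apply: size_le_rowN.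
(* a nonzero coefficient of t^N in each row shows that N is unchanged *)
suff eN r : rowN (row r T') = rowN (row r T).
  by split=> //; apply/matrixP => r c; rewrite mxE eN; case: (key r c).
have /existsP[j Lj] : [exists j, (L *m leading_mx T) r j != 0].
  apply: contraTT Lu; rewrite negb_exists => /forallP h.
  rewrite unitmxE (expand_det_row _ r) big1 ?unitr0 // => j _.
  by have := h j; rewrite negbK => /eqP->; rewrite mul0r.
apply: (@rowN_eq _ _ _ _ _ j) => [j'|]; first by case: (key r j').
by case: (key r j) => ->.
Qed.

Lemma replace_leading_unit : leading_mx T' \in unitmx.
Proof.
by have [L [L1 -> _]] := replace_leading_mx; rewrite unitmx_mul T_reg unitmxE L1 unitr1.
Qed.

Lemma replace_rowN r : rowN (row r T') = rowN (row r T).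
Proof. by have [L [_ _ ->]] := replace_leading_mx. Qed.

Lemma leading_replaced (a : 'I_(size rows)) c : (s <= a)%N ->
  leading_mx T' (e (last_nz P a)) c = \sum_b P a b * leading_mx T (e b) c.
Proof.
move=> sa; rewrite mxE replace_rowN /T' coef_replace_rows //.
  exact: e_increasing.
exact: e_sorted.
Qed.

Lemma leading_unreplaced r c : r \notin D -> leading_mx T' r c = leading_mx T r c.
Proof. by move=> nr; rewrite [LHS]mxE [RHS]mxE replace_rowN /T' replace_rows_id. Qed.

Lemma row_residue_unreplaced r : r \notin D -> row_residue T' r = row_residue T r.
Proof.
move=> nr; rewrite /row_residue; congr residue; apply/rowP => c.
by rewrite [LHS]mxE [RHS]mxE /T' replace_rows_id.
Qed.

(** The new leading row vanishes in the columns of length v because P M does,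
    and in those of greater length because all rows of the class do. *)
Lemma row_residue_replaced r : r \in D -> row_residue T' r < v.
Proof.
case/replacedP => a sa er.
have [[j lj ->] _ _] := row_residueP (leading_row_neq0 r replace_leading_unit).
rewrite ltNge; apply: contraNN lj; rewrite er leading_replaced // => vj.
have [/g_surj[b ->]|wj] := pselect (w j = v).
  have [_ /(_ a b sa) PM0 _ _] := gauss_correct M.
  rewrite -[X in _ == X]PM0 mxE; apply/eqP; apply: eq_bigr => a' _.
  by rewrite /M lead_mxE.
rewrite big1 // => b _; apply/eqP; rewrite mulf_eq0; apply/orP; right.
apply: contraT => lb; case: wj; apply/le_anti; rewrite vj andbT -(class_row_residue b).
by have [_ -> //] := row_residueP (leading_row_neq0 (e b) T_reg).
Qed.

(** The rows left in the class are those whose place is not one of the u_i, and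
    [kernel_last_nz] applies to them. *)
Lemma class_indep_reduced : class_indep v T'.
Proof.
move=> x x0 xs; have xD r : r \in D -> x r = 0.
  by move=> /row_residue_replaced rv; apply: x0; rewrite lt_eqF.
have x0T r : row_residue T r != v -> x r = 0.
  move=> rv; have [/xD//|nr] := boolP (r \in D).
  by apply: x0; rewrite row_residue_unreplaced.
suff y0 : \row_a x (e a) = 0.
  move=> i; have [/e_surj[a ->]|/eqP/x0T//] := pselect (row_residue T i = v).
  by have /rowP/(_ a) := y0; rewrite !mxE.
have [_ _ ker _] := gauss_correct M.
apply: (kernel_last_nz LT ker) => [|a sa]; last first.
  by rewrite mxE xD //; apply/replacedP; exists a.
apply/rowP => b; rewrite [LHS]mxE [RHS]mxE -[RHS](xs (g b) (g_w b)).
have eL i : x i * leading_mx T' i (g b) = x i * leading_mx T i (g b).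
  have [/xD->|nr] := boolP (i \in D); first by rewrite !mul0r.
  by rewrite leading_unreplaced.
rewrite [RHS](eq_bigr _ (fun i _ => eL i)) (sum_rows _ x0T).
by apply: eq_bigr => a' _; rewrite /M lead_mxE mxE.
Qed.

Lemma class_indep_other u : (forall r, r \in D -> row_residue T' r != u) ->
  class_indep u T -> class_indep u T'.
Proof.
move=> Du ind x x0 xs; have xD r : r \in D -> x r = 0.
  by move=> rD; apply: x0; apply: Du.
apply: ind => [r ru|j wj].
  have [/xD//|nr] := boolP (r \in D).
  by apply: x0; rewrite row_residue_unreplaced.
rewrite -[RHS](xs j wj); apply: eq_bigr => i _.
have [/xD->|nr] := boolP (i \in D); first by rewrite !mul0r.
by rewrite leading_unreplaced.
Qed.

End Round.
End RowClasses.

(** * The queue of Stage 2 *)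

Section Queue.
Variable R : realType.

Lemma drop_append (pos : nat) (vals : seq R) x : (pos < size vals)%N ->
  exists t, [/\ append pos vals x = vals ++ t,
    drop pos.+1 (append pos vals x) = drop pos.+1 vals ++ t,
    {subset t <= [:: x]}, x \in drop pos.+1 vals ++ t &
    uniq (drop pos.+1 vals) -> uniq (drop pos.+1 vals ++ t)].
Proof.
move=> lt; rewrite /append; case: ifPn => xq.
  by exists [::]; rewrite !cats0; split.
exists [:: x]; rewrite cats1 drop_rcons // -!cats1 mem_cat mem_head orbT.
by split=> // uq; rewrite cats1 rcons_uniq xq.
Qed.

(** Only the part of [vals] after the current position matters; appending
    extends it without creating duplicates. *)
Lemma drop_foldl_append (pos : nat) (xs vals : seq R) : (pos < size vals)%N ->
  exists t, [/\ (pos < size (foldl (append pos) vals xs))%N,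
    drop pos.+1 (foldl (append pos) vals xs) = drop pos.+1 vals ++ t,
    {subset t <= xs}, {subset xs <= drop pos.+1 vals ++ t} &
    uniq (drop pos.+1 vals) -> uniq (drop pos.+1 vals ++ t)].
Proof.
elim: xs vals => [|x xs IHxs] vals lt.
  by exists [::]; rewrite cats0; split.
have [t1 [e1 d1 s1 m1 u1]] := drop_append x lt.
have lt' : (pos < size (append pos vals x))%N by rewrite e1 size_cat ltn_addr.
have [t2 [lt2 d2 s2 m2 u2]] := IHxs _ lt'; exists (t1 ++ t2).
rewrite /= d2 d1 catA; split=> //.
- by move=> y; rewrite mem_cat => /orP[/s1|/s2]; rewrite !inE => ->; rewrite ?orbT.
- move=> y; rewrite inE => /predU1P[->|/m2]; last by rewrite d1.
  by rewrite mem_cat m1.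
- by move=> uq; rewrite -d1; apply: u2; rewrite d1; apply: u1.
Qed.

(** Double counting of the pairs (v, i) with h i = v. *)
Lemma sum_fibers (n : nat) (h : 'I_n -> R) (q : seq R) : uniq q ->
  (\sum_(v <- q) size [seq i <- enum 'I_n | h i == v] = \sum_i (h i \in q))%N.
Proof.
move=> uq; rewrite (eq_bigr (fun v => \sum_i (h i == v : nat))%N); last first.
  move=> v _; rewrite size_filter -sum1_count big_mkcond big_enum /=.
  by apply: eq_big => i // _; case: eqP.
rewrite exchange_big /=; apply: eq_bigr => i _.
rewrite -count_uniq_mem // -sum1_count [RHS]big_mkcond /=.
by apply: eq_bigr => v _; rewrite eq_sym; case: eqP.
Qed.

Lemma sum_fibers_le (n : nat) (h : 'I_n -> R) (q : seq R) : uniq q ->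
  (\sum_(v <- q) size [seq i <- enum 'I_n | h i == v] <= n)%N.
Proof.
move/sum_fibers->; rewrite -[X in (_ <= X)%N]card_ord -sum1_card.
by apply: leq_sum => i _; case: (_ \in _).
Qed.

End Queue.

Section Stage2.
Variables (R : realType) (k : fieldType) (n : nat) (w : 'I_n -> R).
Hypothesis w_bounds : forall j, -1 < w j <= 0.
Implicit Types (T U : 'M[{poly k}]_n) (v : R).

Let le_norm : rel 'rV[{poly k}]_n := fun a b => (row_norm w a <= row_norm w b)%E.

(** As in Stage 1, a run has no choice. *)
Lemma stage2_inv T vals pos c U : stage2 w T vals pos c U ->
  let v := vals`_pos in
  let T0 := sort_rows le_norm T in
  let rows := class_rows w (class_of w v) T0 in
  let cols := columns w (class_of w v) in
  let e := tnth (in_tuple rows) in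
  let gM := gauss (lead_mx e (tnth (in_tuple cols)) T0) in
  let r := replace_rows e gM.2.1 gM.2.2 T0 in
  if (pos < size vals)%N then
    if gM.2.2 == size rows then
      exists2 c3, c = (gM.1 + c3)%N & stage2 w T0
        (if (size rows < size cols)%N then append pos vals v else vals) pos.+1 c3 U
    else
      exists2 c3, c = (gM.1 + r.1 + c3)%N & stage2 w r.2
        (append_residues w e gM.2.1 gM.2.2 r.2 pos vals) pos.+1 c3 U
  else c = 0%N /\ U = T.
Proof.
case=> [{}T {}vals {}pos /negbTE-> //
  |{}T {}vals {}pos c1 P s c3 {}U -> v T0 rows cols e [eg _ _ _] es vals' run
  |{}T {}vals {}pos c1 P s c2 T' c3 {}U -> v T0 rows cols e [eg _ _ _] ls er run]
  v' T0' rows' cols' e' gM r;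
  have egM : gM = (c1, (P, s)) by rewrite -eg.
  by rewrite egM /= es eqxx; exists c3.
have -> : r = (c2, T') by rewrite -er /r egM.
by rewrite egM /= ltn_eqF //; exists c3.
Qed.

(** The values [v] and [u] are variables here because the size of the matrices
    depends on [u], so that they could not be rewritten afterwards. *)
Lemma stage2_round T vals pos v u : (pos < size vals)%N ->
  vals`_pos = v -> class_of w v = u ->
  let T0 := sort_rows le_norm T in
  let rows := class_rows w u T0 in
  let cols := columns w u in
  let e := tnth (in_tuple rows) in
  let gM := gauss (lead_mx e (tnth (in_tuple cols)) T0) in
  let r := replace_rows e gM.2.1 gM.2.2 T0 in
  let full := if (size rows < size cols)%N then append pos vals v else vals in
  let reduced := append_residues w e gM.2.1 gM.2.2 r.2 pos vals in
  [/\ forall c U, stage2 w T vals pos c U -> if gM.2.2 == size rows then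
        exists2 c3, c = (gM.1 + c3)%N & stage2 w T0 full pos.+1 c3 U
      else exists2 c3, c = (gM.1 + r.1 + c3)%N & stage2 w r.2 reduced pos.+1 c3 U,
    gM.2.2 = size rows -> forall c3 U,
      stage2 w T0 full pos.+1 c3 U -> stage2 w T vals pos (gM.1 + c3) U &
    (gM.2.2 < size rows)%N -> forall c3 U,
      stage2 w r.2 reduced pos.+1 c3 U -> stage2 w T vals pos (gM.1 + r.1 + c3) U].
Proof.
move=> lt <- <- T0 rows cols e gM r full reduced; split.
- by move=> c U /stage2_inv; rewrite lt.
- move=> es c3 U.
  have [ech _ _ _] := gauss_correct (lead_mx e (tnth (in_tuple cols)) T0).
  exact: (Stage2_full lt ech es).
- move=> ls c3 U.
  have [ech _ _ _] := gauss_correct (lead_mx e (tnth (in_tuple cols)) T0).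
  exact: (Stage2_reduce lt ech ls (surjective_pairing r)).
Qed.

(** Orders the classes by their residues, in the role of the index l of r_l. *)
Definition lower_count v : nat := #|[set j | w j < v]|.

Lemma lower_count_lt i j : w i < w j -> (lower_count (w i) < lower_count (w j))%N.
Proof.
move=> lt; apply/proper_card/properP; split.
  by apply/fintype.subsetP => l; rewrite !inE => /lt_trans; apply.
by exists i; rewrite inE ?ltxx.
Qed.

Lemma lower_count_le v : (lower_count v <= n)%N.
Proof. by rewrite -[X in (_ <= X)%N]card_ord max_card. Qed.

Lemma lower_count_n j : (lower_count (w j) < n)%N.
Proof.
rewrite -[X in (_ < X)%N](card_ord n) -cardsT; apply/proper_card/properP.
by split; [apply: finset.subsetT|exists j; rewrite !inE ?ltxx].
Qed.

(** Each replacement lowers the term of its row. *)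
Definition potential T : nat := \sum_i lower_count (row_residue w T i).

Lemma potential_perm g T : potential (row_perm g T) = potential T.
Proof.
rewrite /potential [RHS](reindex_inj (@perm_inj _ g)) /=.
by apply: eq_bigr => i _; rewrite row_residue_perm.
Qed.

Lemma potential_le T : (potential T <= n * n)%N.
Proof.
rewrite -[X in (_ <= X * _)%N]card_ord -sum_nat_const.
by apply: leq_sum => i _; apply: lower_count_le.
Qed.

Lemma row_residue_mem_lens T i : leading_mx T \in unitmx -> row_residue w T i \in lens w.
Proof.
move=> u; have [[j _ ->] _ _] := row_residueP w_bounds (leading_row_neq0 i u).
by apply/mem_lens; exists j.
Qed.

(** An independent class has at most as many rows as columns.  Both numbers add
    up to n over all classes, which forces equality in each class. *)
Lemma all_indep_full T j : leading_mx T \in unitmx -> (forall v, class_indep w v T) ->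
  size (class_rows w (w j) T) = size (columns w (w j)).
Proof.
move=> u ind.
have le j' : (size (class_rows w (w j') T) <= size (columns w (w j')))%N.
  by rewrite -(proj2 (rank_class_indep w_bounds j' u) (ind _)) rank_leq_col.
have tot (h : 'I_n -> R) : (forall i, h i \in lens w) ->
    (\sum_(v <- lens w) size [seq i <- enum 'I_n | h i == v] = n)%N.
  move=> hl; rewrite sum_fibers ?uniq_lens // (eq_bigr (fun _ => 1%N)).
    by rewrite sum_nat_const card_ord muln1.
  by move=> i _; rewrite hl.
have jl : w j \in lens w by apply/mem_lens; exists j.
have := etrans (tot w (fun i => introT (mem_lens w _) (ex_intro _ i erefl)))
  (esym (tot (row_residue w T) (fun i => row_residue_mem_lens i u))).
rewrite !(big_rem _ jl) /= -class_rowsE //.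
have : (\sum_(v <- rem (w j) (lens w)) size [seq i <- enum 'I_n | row_residue w T i == v]
   <= \sum_(v <- rem (w j) (lens w)) size (columns w v))%N.
  rewrite big_seq [X in (_ <= X)%N]big_seq; apply: leq_sum => v /mem_rem/mem_lens[j' ->].
  by rewrite -class_rowsE.
have := le j; rewrite /columns; move: (size _) (size _) => a b.
move: (\sum_(v <- _) _)%N (\sum_(v <- _) _)%N => c d; lia.
Qed.

(** N is the ceiling of the norm, hence sorted with it. *)
Lemma sort_norm T : leading_mx T \in unitmx -> let T0 := sort_rows le_norm T in
  (exists g, T0 = row_perm g T) /\ forall i j : 'I_n, (i <= j)%N ->
    (rowN (row i T0) <= rowN (row j T0))%N.
Proof.
move=> u T0; have tot : total le_norm by move=> a b; apply: le_total.
have trans : transitive le_norm by move=> a b c; apply: le_trans.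
have [g eT0] : exists g : 'S_n, T0 = row_perm g T by exact: sort_rowsP.
split=> [|i j ij]; first by exists g.
have u0 : leading_mx T0 \in unitmx.
  by rewrite eT0 leading_perm row_permE unitmx_mul unitmx_perm.
have := sort_rows_sorted tot trans T ij; rewrite /le_norm -/T0.
have [[i' _ ei] _ ->] := row_residueP w_bounds (leading_row_neq0 i u0).
have [[j' _ ej] _ ->] := row_residueP w_bounds (leading_row_neq0 j u0).
rewrite lee_fin ei ej => le; rewrite -ltnS -(ltr_nat R) -natr1.
by move: le (w_bounds i') (w_bounds j') => le /andP[? ?] /andP[? ?]; lra.
Qed.

Definition good_runs T vals pos (b : nat) : Prop :=
  (exists c U, stage2 w T vals pos c U) /\
  forall c U, stage2 w T vals pos c U ->
    [/\ (c <= b)%N, unimodular_to T U, leading_mx U \in unitmx &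
        forall v, class_indep w v U].

(** The list after the current position is [q1 ++ q2]: what is left of the
    current generation, and the beginning of the next one.  Classes that are not
    in the list are independent.  Those at level [d] or above are settled:
    they are independent, and no row can enter them any more.  The class just
    below can only be dependent if it is still waiting in the current generation,
    so that it is settled when [q1] is exhausted.  At [d = 0] everything is
    settled, and nothing is appended any more. *)
Record queue_inv (H d : nat) (q1 q2 : seq R) T vals pos : Prop := QueueInv {
  inv_regular : leading_mx T \in unitmx;
  inv_rowN : forall r, (rowN (row r T) <= H)%N;
  inv_queue : drop pos vals = q1 ++ q2;
  inv_uniq : uniq (q1 ++ q2);
  inv_lens : {subset q1 ++ q2 <= lens w};
  inv_indep : forall v, v \notin q1 ++ q2 -> class_indep w v T;
  inv_settled : forall v, (d <= lower_count v)%N -> class_indep w v T;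
  inv_next : forall v, (lower_count v).+1 = d -> v \notin q1 -> class_indep w v T;
  inv_last : d = 0%N -> q2 = [::] }.

(** One elimination for each class of the current generation, O(n^3) for each
    later generation, and the cost of a replacement for each unit of the
    potential. *)
Definition budget (H d : nat) (q1 : seq R) T : nat :=
  (\sum_(v <- q1) size (columns w v) * (7 * n ^ 2) + d * (7 * n ^ 3) +
   potential T * (5 * n ^ 2 * H.+1))%N.

(** If the class v is independent, nothing changes except possibly the list.
    Otherwise v lies below level d, the replaced rows go to classes below v,
    which are put in the list, and v becomes independent. *)
Lemma stage2_step H d v q1 q2 T vals pos : queue_inv H d (v :: q1) q2 T vals pos ->
  (forall q2' T' vals', queue_inv H d q1 q2' T' vals' pos.+1 ->
     good_runs T' vals' pos.+1 (budget H d q1 T')) ->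
  good_runs T vals pos (budget H d (v :: q1) T).
Proof.
move=> [u NH eq uq ql qi settled next last] IH.
have /mem_lens[j0 ev] : v \in lens w by apply: ql; rewrite mem_head.
have lt : (pos < size vals)%N.
  by rewrite ltnNge; apply: contra_eqN eq => /drop_oversize->.
have [epos eq'] : vals`_pos = v /\ drop pos.+1 vals = q1 ++ q2.
  by move: eq; rewrite (drop_nth 0 lt) => -[-> ->].
have [[g eT0] srt] := sort_norm u.
set T0 := sort_rows le_norm T in eT0 srt.
have u0 : leading_mx T0 \in unitmx.
  by rewrite eT0 leading_perm row_permE unitmx_mul unitmx_perm.
have ind0 x : class_indep w x T -> class_indep w x T0 by rewrite eT0; apply: class_indep_perm.
have pot0 : potential T0 = potential T by rewrite eT0 potential_perm.
have NH0 r : (rowN (row r T0) <= H)%N by rewrite eT0 rowN_perm.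
have uT0 : unimodular_to T T0 by rewrite eT0; apply: unimodular_perm.
have ecl : class_of w v = w j0 by rewrite ev class_of_w.
have := stage2_round T lt epos ecl; cbv zeta; rewrite -/T0.
set rows := class_rows w (w j0) T0; set cols := columns w (w j0).
set e := tnth (in_tuple rows); set gg := tnth (in_tuple cols).
set M := lead_mx e gg T0.
set c1 := (gauss M).1; set P := (gauss M).2.1; set s := (gauss M).2.2.
set rr := replace_rows e P s T0; set vals' := if _ then _ else _.
set vals'' := append_residues _ _ _ _ _ _ _.
case=> inv_run full reduce.
have [ech _ _ _] := gauss_correct M; rewrite -/c1 -/P -/s in ech.
have [_ LT _ es] := ech.
have c1_le : (c1 <= size cols * (7 * n ^ 2))%N.
  by apply: (gauss_cost _ _ ech); rewrite ?size_rows ?size_cols.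
have uq' : uniq (q1 ++ q2) by move: uq => /= /andP[].
have vq : v \notin q1 ++ q2 by move: uq => /= /andP[].
case: eqP inv_run => [sf|/eqP sf] inv_run.
  have indv : class_indep w v T0.
    by rewrite ev; apply/(rank_class_indep w_bounds j0 u0); rewrite -es.
  have [q2' inv'] : exists q2', queue_inv H d q1 q2' T0 vals' pos.+1.
    have ind' q x : {subset q2 <= q} -> x \notin q1 ++ q -> class_indep w x T0.
      move=> sq; rewrite mem_cat negb_or => /andP[x1 x2].
      have [->//|/eqP xv] := pselect (x = v); apply: ind0; apply: qi.
      rewrite inE negb_or xv mem_cat negb_or x1 /=.
      by apply: contraNN x2; apply: sq.
    have next' x : (lower_count x).+1 = d -> x \notin q1 -> class_indep w x T0.
      move=> xd x1; have [->//|/eqP xv] := pselect (x = v).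
      by apply/ind0/next; rewrite // inE negb_or xv.
    have settled' x : (d <= lower_count x)%N -> class_indep w x T0.
      by move/settled/ind0.
    rewrite /vals'; case: ifP => [fm|_]; last first.
      exists q2; split=> //; last by move=> x; apply: ind'.
      by move=> x xq; apply: ql; rewrite inE xq orbT.
    have [t [_ et st vt ut]] := drop_append v lt.
    rewrite eq' -catA in et vt ut; exists (q2 ++ t); split=> //.
    - exact: ut.
    - move=> x; rewrite catA mem_cat => /orP[xq|/st].
        by apply: ql; rewrite inE xq orbT.
      by rewrite inE => /eqP->; apply: ql; rewrite mem_head.
    - by move=> x; apply: ind' => y yq; rewrite mem_cat yq.
    (* when everything is settled, the class is full and v is not appended *)
    - move=> d0; have := all_indep_full j0 u0 (fun x => settled' x _).
      by rewrite d0 => /(_ (fun=> leq0n _)) e'; rewrite -/rows -/cols e' ltnn in fm.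
  have [[c [U run]] all] := IH _ _ _ inv'; split.
    by exists (c1 + c)%N, U; apply: full.
  move=> {run}c {}U /inv_run[c3 -> /all[c3_le uU Ureg Uind]]; split=> //.
    rewrite (leq_trans (leq_add c1_le c3_le)) //.
    by rewrite /budget big_cons ev -/cols -pot0 !addnA.
  exact: unimodular_trans uT0 uU.
have ls : (s < size rows)%N by rewrite ltn_neqAle sf es rank_leq_row.
(* v is dependent, hence not settled *)
have vd : (lower_count v < d)%N.
  rewrite ltnNge; apply/negP => /settled/ind0; rewrite ev.
  by move/(rank_class_indep w_bounds j0 u0); rewrite -/M -es => /eqP; apply/negP.
have u' : leading_mx rr.2 \in unitmx by exact: replace_leading_unit.
have D_lt r : r \in replaced P e s -> row_residue w rr.2 r < v.
  by rewrite ev; apply: row_residue_replaced.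
have D_count r : r \in replaced P e s ->
    (lower_count (row_residue w rr.2 r) < lower_count v)%N.
  move/D_lt; rewrite ev; have /mem_lens[j ->] := row_residue_mem_lens r u'.
  exact: lower_count_lt.
have indv' : class_indep w v rr.2 by rewrite ev; apply: class_indep_reduced.
have ind' x : (forall r, r \in replaced P e s -> row_residue w rr.2 r != x) ->
    class_indep w x T -> class_indep w x rr.2.
  by move=> Dx /ind0; apply: class_indep_other.
have e_incr (a b : 'I_(size rows)) : (a < b)%N -> (e a < e b)%N.
  exact: e_increasing.
have uR : unimodular_to T rr.2.
  apply: unimodular_trans uT0 _; have [V V1 eV] := replace_rows_mul LT T0 s e_incr.
  by exists V => //; rewrite unitmxE V1 unitr1.
have cD : #|replaced P e s| = (size rows - s)%N by exact: card_replaced.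
have pot : (potential rr.2 + (size rows - s) <= potential T)%N.
  rewrite -pot0 -cD -sum1_card big_mkcond -big_split /=; apply: leq_sum => r _.
  case: ifPn => [rD|nr]; last by rewrite addn0 leq_eqVlt row_residue_unreplaced ?eqxx.
  have -> : row_residue w T0 r = v.
    by case/replacedP: rD => a _ ->; rewrite ev; apply: class_row_residue.
  by rewrite addn1; apply: D_count.
have rr_cost : (rr.1 <= (size rows - s) * (5 * n ^ 2 * H.+1))%N.
  apply: replace_cost => //; first by move=> a b ab; apply: e_sorted.
  exact: size_rows.
have [t [_ et st vt ut]] := drop_foldl_append
  [seq residue w (row (e (last_nz P i)) rr.2) |
    i : 'I_(size rows) <- enum 'I_(size rows) & (s <= i)%N] lt.
have memD r : r \in replaced P e s -> row_residue w rr.2 r \in q1 ++ (q2 ++ t).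
  case/replacedP => a sa ->; rewrite catA -eq'; apply: vt.
  by apply: (map_f (fun i : 'I_(size rows) => residue w (row (e (last_nz P i)) rr.2)));
    rewrite mem_filter sa mem_enum.
have inv' : queue_inv H d q1 (q2 ++ t) rr.2 vals'' pos.+1.
  split=> //.
  - by move=> r; rewrite replace_rowN.
  - by rewrite catA -eq'.
  - by rewrite catA -eq'; apply: ut; rewrite eq'.
  - move=> x; rewrite catA mem_cat => /orP[xq|/st /mapP[a _ ->]].
      by apply: ql; rewrite inE xq orbT.
    exact: row_residue_mem_lens.
  - move=> x xq; have [->//|/eqP xv] := pselect (x = v); apply: ind'.
      by move=> r /memD; apply: contraTneq => ->.
    apply: qi; rewrite inE negb_or xv /=.
    by apply: contraNN xq => h; rewrite catA mem_cat h.
  - move=> x dx; apply: ind'; last exact: settled.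
    move=> r /D_count; apply: contraTneq => ->.
    by rewrite -leqNgt (leq_trans (ltnW vd)).
  - move=> x xd xq; have [->//|/eqP xv] := pselect (x = v); apply: ind'.
      move=> r /D_count; apply: contraTneq => ->.
      by rewrite -leqNgt -ltnS xd.
    by apply: next; rewrite // inE negb_or xv.
  - by move=> d0; move: vd; rewrite d0.
have [[c [U run]] all] := IH _ _ _ inv'; split.
  by exists (c1 + rr.1 + c)%N, U; apply: reduce.
move=> {run}c {}U /inv_run[c3 -> /all[c3_le uU Ureg Uind]]; split=> //.
  rewrite (leq_trans (leq_add (leq_add c1_le rr_cost) c3_le)) //.
  rewrite /budget big_cons ev -/cols.
  have := leq_mul pot (leqnn (5 * n ^ 2 * H.+1)%N); rewrite mulnDl.
  by move: (_ * (5 * _ * _))%N (_ * (5 * _ * _))%N (_ * (5 * _ * _))%N; lia.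
exact: unimodular_trans uR uU.
Qed.

(** Induction on the level d, and on the current generation.  When it is
    exhausted, the next generation has distinct entries, hence its eliminations
    are paid by the share 7 n^3 of level d. *)
Lemma stage2_spec H d q1 q2 T vals pos : queue_inv H d q1 q2 T vals pos ->
  good_runs T vals pos (budget H d q1 T).
Proof.
have stop (b : nat) T' vals' pos' : leading_mx T' \in unitmx ->
    (forall v, class_indep w v T') -> drop pos' vals' = [::] -> good_runs T' vals' pos' b.
  move=> u ind dr; have ge : ~~ (pos' < size vals')%N.
    by rewrite -leqNgt -subn_eq0 -size_drop dr.
  split; first by exists 0%N, T'; apply: Stage2_end.
  move=> c U /stage2_inv; rewrite (negPf ge) => -[-> ->].
  by split=> //; apply: unimodular_refl.
elim: d q1 q2 T vals pos => [|d IHd] q1.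
  elim: q1 => [|v q1 IHq] q2 T vals pos inv; last first.
    by apply: stage2_step inv _ => q2' T' vals'; apply: IHq.
  case: inv => u _ dr _ _ _ settled _ last; apply: stop => //.
    by move=> v; apply: settled.
  by rewrite dr last.
elim: q1 => [|v q1 IHq] q2 T vals pos inv; last first.
  by apply: stage2_step inv _ => q2' T' vals'; apply: IHq.
case: inv => u NH dr uq ql ind settled next _.
case: q2 dr uq ql ind => [|v q2] dr uq ql ind.
  by apply: stop => // v; apply: ind.
have inv : queue_inv H d (v :: q2) [::] T vals pos.
  split; rewrite ?cats0 // => x.
    by rewrite leq_eqVlt => /predU1P[dx|]; [apply: next; rewrite // -dx|apply: settled].
  by move=> _; apply: ind.
have [ex all] := IHd _ _ _ _ _ inv; split=> // c U /all[c_le uU Ureg Uind].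
split=> //; apply: (leq_trans c_le); rewrite /budget big_nil add0n leq_add2r.
rewrite mulSn leq_add2r -big_distrl /= mulnC [X in (_ <= X)%N](_ : _ = 7 * n ^ 2 * n)%N.
  by rewrite leq_mul2l sum_fibers_le ?orbT.
by rewrite -mulnA -expnSr.
Qed.

End Stage2.

(** * Independent classes give a reduced family *)

(** The convolution sum has a single nonzero term. *)
Lemma coefM_top (A : nzRingType) (p q : {poly A}) a b :
  (size p <= a.+1)%N -> (size q <= b.+1)%N -> (p * q)`_(a + b) = p`_a * q`_b.
Proof.
move=> pa qb; have lt : (a < (a + b).+1)%N by rewrite ltnS leq_addr.
rewrite coefM (bigD1 (Ordinal lt)) //= addKn big1 ?addr0 // => i.
rewrite -val_eqE /= neq_ltn => /orP[ia|ai]; last first.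
  by rewrite (leq_sizeP _ _ pa) ?mul0r.
by rewrite (leq_sizeP _ _ qb) ?mulr0 //; lia.
Qed.

Section ReducedRows.
Variables (R : realType) (k : fieldType) (n : nat) (w : 'I_n -> R).
Hypothesis w_bounds : forall j, -1 < w j <= 0.
Variable U : 'M[{poly k}]_n.
Hypothesis U_reg : leading_mx U \in unitmx.
Hypothesis U_indep : forall v, class_indep w v U.

(** Let mu = m + r be the maximal norm of a term p_l U_l, with r the residue of
    a row where it is attained.  In a column of length r, a term contributes to
    the coefficient of t^m only if its row is in the class r, and then its
    contribution is its leading coefficient times the coefficient of t^(m - N) in
    p_l.  Independence of the class provides a column where the sum of these
    contributions is not zero, and there the norm mu is attained. *)
Lemma row_norm_combination_ge (p : 'I_n -> {poly k}) i :
  (degR R (p i)%:F + row_norm w (row i U) <=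
   row_norm w (\row_j \sum_i p i * U i j)%R)%E.
Proof.
have [p0|pi] := eqVneq (p i) 0.
  by rewrite p0 tofrac0 degR0 addNye leNye.
pose N l := rowN (row l U).
pose mu l : R := (size (p l)).-1%:R + (N l)%:R + row_residue w U l.
pose i0 := [arg max_(l > i | p l != 0) mu l]%O.
have [pi0 mu_max] : p i0 != 0 /\ forall l, p l != 0 -> mu l <= mu i0.
  by rewrite /i0; case: Order.TotalTheory.arg_maxP.
have norm l : row_norm w (row l U) = ((N l)%:R + row_residue w U l)%:E.
  by have [_ _ ->] := row_residueP w_bounds (leading_row_neq0 l U_reg).
apply: (@le_trans _ _ (mu i0)%:E).
  by rewrite degR_tofrac // norm -EFinD lee_fin addrA mu_max.
pose m := ((size (p i0)).-1 + N i0)%N; set r := row_residue w U i0 in mu_max *.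
have [[j0 _ er] _ _] := row_residueP w_bounds (leading_row_neq0 i0 U_reg).
have mu0 : mu i0 = m%:R + r by rewrite /mu /m natrD.
(* residues differ by less than 1, so the maximality of mu bounds degrees by m,
   strictly for rows of a greater residue *)
have dm l : p l != 0 -> ((size (p l)).-1 + N l <= m)%N /\
    (r < row_residue w U l -> ((size (p l)).-1 + N l < m)%N).
  move=> pl; have [[j _ el] _ _] := row_residueP w_bounds (leading_row_neq0 l U_reg).
  have := mu_max _ pl; rewrite mu0 /mu -natrD el /r er.
  move: (w_bounds j) (w_bounds j0) => /andP[j1 j2] /andP[j01 j02] le.
  split=> [|lt]; last by rewrite -(ltr_nat R); lra.
  by rewrite -ltnS -(ltr_nat R) -natr1; lra.
pose x l := if row_residue w U l == r then (p l)`_(m - N l) else 0.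
have x_i0 : x i0 != 0.
  by rewrite /x eqxx /m addnK -/(lead_coef _) lead_coef_eq0.
have coefm l j : w j = r -> (p l * U l j)`_m = x l * leading_mx U l j.
  move=> wj; rewrite /x; have [->|pl] := eqVneq (p l) 0.
    by rewrite mul0r !coef0 if_same mul0r.
  have [le lt] := dm l pl.
  have Nm : (N l <= m)%N by apply: leq_trans le; rewrite leq_addl.
  have sz : (size (p l) <= (m - N l).+1)%N by lia.
  rewrite -[in LHS](subnK Nm) (coefM_top sz (size_le_rowN U l j)).
  have -> : (U l j)`_(N l) = leading_mx U l j by rewrite mxE.
  case: eqVneq => // lr; have [->|lj] := eqVneq (leading_mx U l j) 0.
    by rewrite !mulr0.
  have {}lr : r < row_residue w U l.
    rewrite lt_neqAle eq_sym lr -wj.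
    by have [_ -> //] := row_residueP w_bounds (leading_row_neq0 l U_reg).
  have sz' : (size (p l) <= m - N l)%N by have := lt lr; lia.
  by rewrite (leq_sizeP _ _ sz') // !mul0r.
have /existsP[j /andP[/eqP wj cj]] : [exists j, (w j == r) &&
    (\sum_l x l * leading_mx U l j != 0)].
  apply: contraT; rewrite negb_exists => /forallP no.
  suff x0 : x i0 = 0 by rewrite x0 eqxx in x_i0.
  apply: (U_indep (v := r)) => [l lr|j wj]; first by rewrite /x (negPf lr).
  by have := no j; rewrite wj eqxx /= negbK => /eqP.
apply: le_trans (le_bigmax _ _ j); rewrite mxE mu0 wj.
set q := \sum_i _; have qm : q`_m != 0.
  rewrite /q coef_sum (eq_bigr (fun l => x l * leading_mx U l j)) // => l _.
  exact: coefm.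
have q0 : q != 0 by apply: contraNneq qm => ->; rewrite coef0.
rewrite degR_tofrac // lee_fin lerD2r ler_nat -ltnS prednK ?size_poly_gt0 //.
by rewrite ltnNge; apply: contraNN qm => /leq_sizeP->.
Qed.

End ReducedRows.

(** * From rows to vectors *)

Section NormedSpace.
Variables (R : realType) (k : fieldType) (n : nat).
Local Notation K := {fraction {poly k}}.
Variables (E : vectType K) (nrm : E -> \bar R) (B' : n.-tuple E).
Hypothesis nrmP : is_norm nrm.
Hypothesis B'P : orthonormal_basis nrm B'.
Let w (j : 'I_n) : R := fine (nrm (tnth B' j)).

Lemma nrm_basis j : nrm (tnth B' j) = (w j)%:E.
Proof.
have [_ _ /(_ j)/andP[gt le] _] := B'P; rewrite fineK //.
by rewrite fin_numE -ltNye -ltey (lt_trans _ gt) ?ltNyr // (le_lt_trans le) ?ltry.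
Qed.

Lemma basis_lengths_bounds j : -1 < w j <= 0.
Proof. by have [_ _ /(_ j) + _] := B'P; rewrite nrm_basis lte_fin lee_fin. Qed.

Lemma tnth_family (U : 'M[{poly k}]_n) i :
  tnth (family_of B' U) i = \sum_j (U i j)%:F *: tnth B' j.
Proof. by rewrite tnth_mktuple. Qed.

Lemma nrm_row (a : 'rV[{poly k}]_n) :
  nrm (\sum_j (a 0 j)%:F *: tnth B' j) = row_norm w a.
Proof.
have [_ [_ ->] _ _] := B'P; have [_ _ nZ _] := nrmP.
by apply: eq_bigr => j _; rewrite nZ nrm_basis.
Qed.

Lemma nrm_sum_le (I : Type) (s : seq I) (f : I -> E) :
  (nrm (\sum_(i <- s) f i) <= \big[maxe/-oo%E]_(i <- s) nrm (f i))%E.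
Proof.
have [_ nD _ n0] := nrmP; elim: s => [|i s IHs].
  by rewrite !big_nil (proj2 (n0 0)).
rewrite !big_cons (le_trans (nD _ _)) // ge_max le_max lexx /=.
by rewrite le_max IHs orbT.
Qed.

Lemma family_combination (U : 'M[{poly k}]_n) (p : 'I_n -> {poly k}) :
  \sum_i (p i)%:F *: tnth (family_of B' U) i =
  \sum_j ((\row_j \sum_i p i * U i j) 0 j)%:F *: tnth B' j.
Proof.
under eq_bigr => i _ do rewrite tnth_family scaler_sumr.
rewrite exchange_big /=; apply: eq_bigr => j _.
rewrite mxE rmorph_sum scaler_suml; apply: eq_bigr => i _.
by rewrite scalerA -tofracM.
Qed.

Lemma common_denominator (a : 'I_n -> K) : exists2 q : {poly k}, q != 0 &
  exists p : 'I_n -> {poly k}, forall i, q%:F * a i = (p i)%:F.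
Proof.
pose d i := \d_(repr (a i)); pose u i := \n_(repr (a i)).
have d0 i : d i != 0 by apply: denom_ratioP.
exists (\prod_i d i); first by apply/prodf_neq0.
exists (fun i => (\prod_(j | j != i) d j) * u i) => i.
have dF0 : (d i)%:F != 0 :> K by rewrite tofrac_eq0.
rewrite (bigD1 i) //= [a i]fracE -/(d i) -/(u i) !tofracM.
by rewrite -mulrA mulrCA; congr (_ * _); rewrite mulrCA mulfV ?mulr1.
Qed.

(** Multiplying all coefficients by a common denominator q adds the degree of q
    to both sides, so that polynomial coefficients are enough. *)
Lemma indep_reduced_family (U : 'M[{poly k}]_n) : leading_mx U \in unitmx ->
  (forall v, class_indep w v U) -> reduced_family nrm (family_of B' U).
Proof.
move=> ureg uind; have [_ _ nZ n0] := nrmP; set b := family_of B' U.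
have nb i : nrm (tnth b i) = row_norm w (row i U).
  rewrite tnth_family -nrm_row; congr nrm.
  by apply: eq_bigr => j _; rewrite mxE.
have poly_ge (p : 'I_n -> {poly k}) i :
    (nrm ((p i)%:F *: tnth b i) <= nrm (\sum_i (p i)%:F *: tnth b i)%R)%E.
  rewrite family_combination nrm_row nZ nb.
exact: (row_norm_combination_ge basis_lengths_bounds ureg uind p i).
split=> [i|a].
  apply/eqP => /(proj2 (n0 _)); rewrite nb.
  by have [_ _ ->] := row_residueP basis_lengths_bounds (leading_row_neq0 i ureg).
apply/le_anti/andP; split; first exact: nrm_sum_le.
apply/bigmax_leP; split=> [|i _]; first exact: leNye.
have [q q0 [p ep]] := common_denominator a.
have fq : degR R q%:F \is a fin_num by rewrite degR_tofrac.
rewrite -(leeD2lE _ _ fq) -!nZ scalerA ep scaler_sumr.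
under eq_bigr => l _ do rewrite scalerA ep.
exact: poly_ge.
Qed.

Lemma Aspan_tuple (b : n.-tuple E) : Aspan b =
  [set x | exists a : 'I_n -> {poly k}, x = \sum_i (a i)%:F *: tnth b i]%classic.
Proof.
have sz : size b = n by rewrite size_tuple.
apply/seteqP; split=> x [a ->].
  exists (fun i => a i).
  rewrite -(big_mkord xpredT (fun i => (a i)%:F *: b`_i)) sz big_mkord.
  by apply: eq_bigr => i _; rewrite (tnth_nth 0).
exists (fun l => if insub l is Some i then a i else 0).
rewrite -(big_mkord xpredT (fun l =>
  (if insub l is Some i then a i else 0)%:F *: b`_l)) sz big_mkord.
by apply: eq_bigr => i _; rewrite valK (tnth_nth 0).
Qed.

Lemma family_mul_sub (V T : 'M[{poly k}]_n) :
  (Aspan (family_of B' (V *m T)) `<=` Aspan (family_of B' T))%classic.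
Proof.
rewrite !Aspan_tuple => x [a ->].
exists (fun l => \sum_i a i * V i l); rewrite !family_combination.
apply: eq_bigr => j _; rewrite !mxE; congr (_%:F *: _).
under eq_bigr => i _ do rewrite mxE mulr_sumr.
rewrite exchange_big /=; apply: eq_bigr => l _.
by rewrite mulr_suml; apply: eq_bigr => i _; rewrite mulrA.
Qed.

(** Unimodular matrices preserve the span.  A relation over A would have norm
    -oo, and in a reduced family so would each of its terms. *)
Lemma reduced_Abasis (T U : 'M[{poly k}]_n) : unimodular_to T U ->
  reduced_family nrm (family_of B' U) ->
  Abasis (Aspan (family_of B' T)) (family_of B' U).
Proof.
case=> V Vu eU [nz red]; split.
  apply/seteqP; split; first by rewrite eU; apply: family_mul_sub.
  have -> : T = invmx V *m U by rewrite eU mulKmx.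
  exact: family_mul_sub.
move=> a a0 i; have [_ _ nZ n0] := nrmP.
have : nrm ((a i)%:F *: tnth (family_of B' U) i) = -oo%E.
  apply/le_anti; rewrite leNye andbT.
  rewrite -(proj2 (n0 0) erefl) -a0 red.
  exact: (le_bigmax _ (fun i => nrm ((a i)%:F *: tnth (family_of B' U) i))).
move/(proj1 (n0 _))/eqP; rewrite scaler_eq0 (negPf (nz i)) orbF tofrac_eq0.
by move/eqP.
Qed.

Lemma transition_family (B : n.-tuple E) (T : 'M[{poly k}]_n) :
  transition B B' = map_mx (@tofrac {poly k}) T -> B = family_of B' T.
Proof.
move=> eT; apply: eq_from_tnth => i; rewrite tnth_family.
have [bB' _ _ _] := B'P.
rewrite {1}(coord_basis bB' (memvf (tnth B i))); apply: eq_bigr => j _.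
have /matrixP/(_ i j) := eT; rewrite !mxE => ->.
by rewrite (tnth_nth 0).
Qed.

(** A left kernel vector of T would be a linear relation between the elements
    of B. *)
Lemma transition_det (B : n.-tuple E) (T : 'M[{poly k}]_n) :
  basis_of fullv B ->
  transition B B' = map_mx (@tofrac {poly k}) T -> \det T != 0.
Proof.
move=> bB eT; rewrite -(tofrac_eq0 (\det T)) -det_map_mx -eT.
apply/det0P => -[v v0 vT]; case/eqP: v0; apply/rowP => i; rewrite mxE.
have /freeP := basis_free bB; apply.
have [bB' _ _ _] := B'P.
rewrite (eq_bigr (fun i => \sum_j (v 0 i * transition B B' i j) *: tnth B' j)).
  rewrite exchange_big /= big1 // => j _; rewrite -scaler_suml.
  by have /rowP/(_ j) := vT; rewrite [LHS]mxE [RHS]mxE => ->; rewrite scale0r.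
move=> l _; rewrite -(tnth_nth 0) {1}(coord_basis bB' (memvf (tnth B l))).
rewrite scaler_sumr; apply: eq_bigr => j _.
by rewrite scalerA [transition _ _ _ _]mxE (tnth_nth 0 B').
Qed.

End NormedSpace.

(** * The theorem *)

(** The two terms of the bound come from the n h rounds of Stage 1 with
    eliminations of cost 7 n^3, together with the n^2 replacements of Stage 2, and
    from the n h replacements of Stage 1.  For n = 0 the cost is zero. *)
Lemma cost_bounds (n h c1 c2 D Phi : nat) : (D <= n * h)%N -> (Phi <= n * n)%N ->
  (c1 <= 7 * n ^ 3 + (7 * n ^ 3 + 5 * n ^ 2 * h.+1) * D)%N ->
  (c2 <= 7 * n ^ 3 + n * (7 * n ^ 3) + Phi * (5 * n ^ 2 * h.+1))%N ->
  ((0 < h)%N -> (c1 + c2 <= 38 * (n ^ 4 * h + n ^ 3 * h ^ 2))%N) /\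
  ((n <= h)%N -> (c1 + c2 <= 76 * (n ^ 3 * h ^ 2))%N).
Proof.
move=> Dh Phin le1 le2.
have main : (0 < h)%N -> (c1 + c2 <= 38 * (n ^ 4 * h + n ^ 3 * h ^ 2))%N.
  move=> h_gt0; have hh : (h.+1 <= 2 * h)%N by lia.
  have le1' : (c1 <= 7 * n ^ 3 + (7 * n ^ 3 + 5 * n ^ 2 * (2 * h)) * (n * h))%N.
    by rewrite (leq_trans le1) // leq_add2l leq_mul // leq_add2l leq_mul.
  have le2' : (c2 <= 7 * n ^ 3 + n * (7 * n ^ 3) + n * n * (5 * n ^ 2 * (2 * h)))%N.
    by rewrite (leq_trans le2) // leq_add2l leq_mul // leq_mul.
  have n34 : (n ^ 3 <= n ^ 4)%N by case: (n) => // n'; rewrite leq_pexp2l.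
  have n4h : (n ^ 4 <= n ^ 4 * h)%N by rewrite leq_pmulr.
  have e1 : ((7 * n ^ 3 + 5 * n ^ 2 * (2 * h)) * (n * h) =
    7 * (n ^ 4 * h) + 10 * (n ^ 3 * h ^ 2))%N by ring.
  have e2 : (n * (7 * n ^ 3) + n * n * (5 * n ^ 2 * (2 * h)) =
    7 * n ^ 4 + 10 * (n ^ 4 * h))%N by ring.
  rewrite -addnA in le2'; rewrite e1 in le1'; rewrite e2 in le2'.
  move: (n ^ 4 * h)%N (n ^ 3 * h ^ 2)%N (n ^ 4)%N (n ^ 3)%N n34 n4h le1' le2'; lia.
split=> // nh; have [n0|n_gt0] := posnP n.
  move: le1 le2; rewrite n0 !exp0n // !(muln0, mul0n) !addn0. lia.
have h_gt0 : (0 < h)%N by exact: leq_trans nh.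
rewrite (leq_trans (main h_gt0)) //.
have : (n ^ 4 * h <= n ^ 3 * h ^ 2)%N.
  by rewrite expnSr (expnS h 1) expn1 -mulnA leq_mul2l leq_mul2r nh !orbT.
lia.
Qed.

Theorem lemma2p26 :
  exists C C' : nat,
  forall (R : realType) (k : fieldType) (n : nat)
    (E : vectType {fraction {poly k}}) (nrm : E -> \bar R)
    (B' B : n.-tuple E) (T : 'M[{poly k}]_n),
  normed_space nrm ->
  orthonormal_basis nrm B' ->
  basis_of fullv B ->
  transition B B' = map_mx (@tofrac {poly k}) T ->
  let h := height_mx (transition B B') in
  let w := fun j : 'I_n => fine (nrm (tnth B' j)) in
  (exists c U, basis_reduction w T c U) /\
  (forall (c : nat) (U : 'M[{poly k}]_n), basis_reduction w T c U ->
    [/\ Abasis (Aspan B) (family_of B' U),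
        reduced_family nrm (family_of B' U),
        (0 < h)%N -> (c <= C * (n ^ 4 * h + n ^ 3 * h ^ 2))%N
      & (n <= h)%N -> (c <= C' * (n ^ 3 * h ^ 2))%N]).
Proof.
exists 38%N, 76%N => R k n E nrm B' B T [nrmP _] B'P bB eT h w.
have wb : forall j, -1 < w j <= 0 by move=> j; apply: basis_lengths_bounds B'P j.
have T_det := transition_det B'P bB eT.
have Th r : (rowN (row r T) <= h)%N.
  apply/bigmax_leqP => j _; rewrite mxE.
  apply: (leq_trans (height_tofrac _)).
  rewrite /h /height_mx eT.
  apply: (leq_trans _ (leq_bigmax r)); apply: (leq_trans _ (leq_bigmax j)).
  by rewrite mxE.
have T1 : (n <= 1)%N -> leading_mx T \in unitmx.
  case: (n) T T_det {eT Th} => [|[|//]] T' T'_det _.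
    by rewrite unitmxE det_mx00 unitr1.
  rewrite unitmxE det_mx11 unitfE.
  by have [j] := det_neq0_leading_row 0 T'_det; rewrite (ord1 j).
have [[c1 [U1 run1]] all1] := stage1_spec T_det Th T1.
have D_le : (total_degree T <= n * h)%N.
  by rewrite -[X in (_ <= X * _)%N]card_ord -sum_nat_const; apply: leq_sum.
(* Stage 2 starts at level n, where no class is settled, and all lengths form
   the first generation. *)
have inv U : leading_mx U \in unitmx -> (forall r, (rowN (row r U) <= h)%N) ->
    queue_inv w h n (lens w) [::] U (lens w) 0.
  move=> u Uh; have triv v : v \notin lens w -> class_indep w v U.
    move=> vl; apply: class_indep_empty => // j.
    by apply: contraNneq vl => <-; apply/mem_lens; exists j.
  split; rewrite ?cats0 ?drop0 ?uniq_lens // => v; last by move=> _; apply: triv.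
  move=> nv; apply: triv; apply/negP => /mem_lens[j ev].
  by have := lower_count_n w j; rewrite -ev ltnNge nv.
have runs2 c U : stage1 1 T c U ->
    good_runs w U (lens w) 0 (budget w h n (lens w) U).
  by move=> /all1[_ _ Uh Ureg]; apply/(stage2_spec wb)/inv.
split.
  have [[c2 [U run2]] _] := runs2 _ _ run1.
  by exists (c1 + c2)%N, U, c1, U1, c2.
move=> {c1 U1 run1}c U [c1 [U1 [c2 [run1 run2 ->]]]].
have [c1_le uU1 _ _] := all1 _ _ run1.
have [c2_le uU Ureg Uind] := (runs2 _ _ run1).2 _ _ run2.
have red := indep_reduced_family nrmP B'P Ureg Uind.
have {}c2_le : (c2 <= 7 * n ^ 3 + n * (7 * n ^ 3) +
    potential w U1 * (5 * n ^ 2 * h.+1))%N.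
  rewrite (leq_trans c2_le) // /budget !leq_add2r -big_distrl /=.
  rewrite [X in (_ <= X)%N](_ : _ = n * (7 * n ^ 2))%N; last by ring.
  by rewrite leq_mul2r sum_fibers_le ?uniq_lens ?orbT.
have [bound bound'] := cost_bounds D_le (potential_le w U1) c1_le c2_le.
split=> //.
rewrite [in Aspan B](transition_family B'P eT).
exact: (reduced_Abasis nrmP (unimodular_trans uU1 uU)).
Qed.
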